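(* Let $n$ be a positive integer, $\tau>0$, and $a_0,\dots,a_{n-1},\alpha_0,\dots,\alpha_{n-1}\in\mathbb R$. Consider the quasipolynomial $\Delta:\mathbb C\to\mathbb C$, \[ \Delta(s)=s^n+\sum_{k=0}^{n-1}a_k s^k+e^{-s\tau}\sum_{k=0}^{n-1}\alpha_k s^k , \] and let $s_0\in\mathbb R$. (a) $s_0$ is a root of multiplicity $2n$ of $\Delta$ if and only if, for every $k\in\{0,\dots,n-1\}$, \[ a_k=\binom{n}{k}(-s_0)^{n-k}+(-1)^{n-k}\,n!\sum_{j=k}^{n-1}\binom{j}{k}\binom{2n-j-1}{n-1}\frac{s_0^{\,j-k}}{j!\,\tau^{n-j}}, \qquad \alpha_k=(-1)^{n-1}e^{s_0\tau}\sum_{j=k}^{n-1}\frac{(-1)^{j-k}(2n-j-1)!}{k!\,(j-k)!\,(n-j-1)!}\frac{s_0^{\,j-k}}{\tau^{n-j}}. \] (b) If the coefficients satisfy the conditions in (a), then $s_0$ is a strictly dominant root of $\Delta$, i.e., every root $s\neq s_0$ of $\Delta$ satisfies $\operatorname{Re} s<s_0$. (c) If the coefficients satisfy the conditions in (a), then the trivial solution of the delay-differential equation \[ y^{(n)}(t)+a_{n-1}y^{(n-1)}(t)+\dots+a_0y(t)+\alpha_{n-1}y^{(n-1)}(t-\tau)+\dots+\alpha_0y(t-\tau)=0 \] (with real-valued unknown $y$) is exponentially stable if and only if $a_{n-1}>-\frac{n^2}{\tau}$.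
   Context: Binomial coefficients $\binom{m}{k}$ are the usual ones. A root $s_0$ of $\Delta$ has multiplicity $2n$ when $\Delta^{(k)}(s_0)=0$ for $k=0,\dots,2n-1$ (multiplicity can be at most $2n$ for this quasipolynomial). The trivial solution of the delay-differential equation is exponentially stable if there exist $C,\gamma>0$ such that every solution satisfies $|y(t)|\le Ce^{-\gamma t}\max_{\theta\in[-\tau,0]}|y(\theta)|$ for $t\ge0$ (for retarded equations this is equivalent to all roots of $\Delta$ having real part bounded by a negative number, i.e., the spectral abscissa $\sup\{\operatorname{Re}s:\Delta(s)=0\}$ being negative).
   Formalization: In (c), stability is measured against the maximum over the history of |y| and its derivatives up to order n-1 (with max |y| alone, (c) fails for n ≥ 2), and solutions are taken n times differentiable on the whole line; histories of class C^{n-1} follow by density. *)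

(* Defs.v *)
From HB Require Import structures.
From mathcomp Require Import all_boot all_order all_algebra.
From mathcomp Require Import all_classical all_reals all_analysis.
From mathcomp Require Import complex.
Set Implicit Arguments.
Unset Strict Implicit.
Unset Printing Implicit Defensive.
Import Order.TTheory GRing.Theory Num.Theory.
Import numFieldNormedType.Exports.
Local Open Scope ring_scope.

(* The complex numbers over a real type R, as a numFieldType; its norm is the
   complex modulus, hence it carries the usual topology, and derive1 /
   derive1n give the complex derivative. *)
Definition Cx (R : realType) : numFieldType := R[i].

Definition RtoC (R : realType) (x : R) : Cx R := Complex x 0.

Definition cexp (R : realType) (z : Cx R) : Cx R :=
  Complex (expR (complex.Re z) * cos (complex.Im z)) (expR (complex.Re z) * sin (complex.Im z)).

Definition Delta (R : realType) (n : nat) (tau : R) (a alpha : nat -> R)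
    (s : Cx R) : Cx R :=
  s ^+ n + \sum_(k < n) RtoC (a k) * s ^+ k
  + cexp (- (s * RtoC tau)) * \sum_(k < n) RtoC (alpha k) * s ^+ k.

Definition root_of_multiplicity (R : realType) (f : Cx R -> Cx R)
    (s0 : Cx R) (m : nat) : Prop :=
  forall k : nat, (k < m)%N -> derive1n k f s0 = 0.

Definition a_formula (R : realType) (n : nat) (tau s0 : R) (k : nat) : R :=
  ('C(n, k))%:R * (- s0) ^+ (n - k)
  + (-1) ^+ (n - k) * (n`!)%:R *
    \sum_(k <= j < n)
       ('C(j, k) * 'C(2 * n - j - 1, n - 1))%:R * s0 ^+ (j - k)
         / ((j`!)%:R * tau ^+ (n - j)).

Definition alpha_formula (R : realType) (n : nat) (tau s0 : R) (k : nat) : R :=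
  (-1) ^+ (n - 1) * expR (s0 * tau) *
  \sum_(k <= j < n)
     (-1) ^+ (j - k) * ((2 * n - j - 1)`!)%:R
       / ((k`! * (j - k)`! * (n - j - 1)`!)%:R)
       * s0 ^+ (j - k) / tau ^+ (n - j).

Definition coeff_conditions (R : realType) (n : nat) (tau s0 : R)
    (a alpha : nat -> R) : Prop :=
  forall k : nat, (k < n)%N ->
    a k = a_formula n tau s0 k /\ alpha k = alpha_formula n tau s0 k.

Definition strictly_dominant_root (R : realType) (f : Cx R -> Cx R) (s0 : R)
    : Prop :=
  forall s : Cx R, f s = 0 -> s <> RtoC s0 -> complex.Re s < s0.

Definition dde_solution (R : realType) (n : nat) (tau : R) (a alpha : nat -> R)
    (y : R -> R) : Prop :=
  (forall k : nat, (k < n)%N -> forall t : R, derivable (derive1n k y) t 1)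
  /\ forall t : R, 0 <= t ->
       derive1n n y t + \sum_(k < n) a k * derive1n k y t
       + \sum_(k < n) alpha k * derive1n k y (t - tau) = 0.

(* Exponential stability of the trivial solution: there are C, gamma > 0 with
   |y(t)| <= C e^{-gamma t} ||y_0|| for every solution and t >= 0, where
   ||y_0|| is the norm of the initial history on [-tau, 0] in the natural
   state space of the n-th order retarded equation, i.e.
   max_{k<n} max_{theta in [-tau,0]} |y^(k)(theta)|  (expressed via any
   upper bound M of these quantities). *)
Definition exp_stable (R : realType) (n : nat) (tau : R) (a alpha : nat -> R)
    : Prop :=
  exists C gamma : R, 0 < C /\ 0 < gamma /\
    forall y : R -> R, dde_solution n tau a alpha y ->
    forall M : R,
      (forall k : nat, (k < n)%N -> forall theta : R, - tau <= theta <= 0 ->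
         `|derive1n k y theta| <= M) ->
    forall t : R, 0 <= t -> `|y t| <= C * expR (- (gamma * t)) * M.

(* Main.v *)
(* The quasipolynomial Delta (s0 + s) = P(s) + e^(-s tau) Q(s), with P monic of
   degree n and deg Q < n, has a zero of order 2n at 0 iff q_j := Q(D) (v^j / j!)
   satisfies q_j(-tau) = - P_j for all j < 2n.  In particular q_(2n-1) is a
   multiple of X^n (X + tau)^(n-1), and its Taylor coefficients at 0 and at
   -tau are the explicit formulas of (a).

   Dominance and stability come from one energy identity.  Let Z solve
   P(D) Z(t) + Q(D) Z(t - tau) = 0, let T_t Z be its Taylor polynomial of degree
   n - 1 at t, let E(t) be the integral of (Q(D)(Z - T_t Z))^2 over [t - tau, t]
   and L_j(t) that of Q(D)(Z - T_t Z) q_j(. - t).  The 2n conditions give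
   int_(-tau)^0 q_(n-1) q_j = - P_j for j < n, hence
     E' = - (Z^(n))^2 - 2 Z^(n) L_(n-1)   and   L_j' = - L_(j-1).
   Since E >= 0, adding small multiples of the (Z^(k))^2, k < n, and large
   multiples of the L_j^2 gives a Lyapunov function with S' <= 4 eps S, so that
   Z grows slower than every exponential; undoing the shift, the solutions decay
   as soon as s0 < 0.  For Z = e^(sigma t) one gets L_j = 0, and the identity
   reads 2 Re(sigma) E(0) = - |sigma|^(2n), which forces Re sigma < 0 unless
   sigma = 0. *)
Require Import Defs.
From HB Require Import structures.
From mathcomp Require Import all_boot all_order all_algebra.
From mathcomp Require Import all_classical all_reals all_analysis.
From mathcomp Require Import complex.
From mathcomp Require Import ring lra zify.
Set Implicit Arguments.
Unset Strict Implicit.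
Unset Printing Implicit Defensive.
Import Order.TTheory GRing.Theory Num.Theory.
Import numFieldNormedType.Exports.
Local Open Scope ring_scope.

(** * Integrals of continuous functions *)

Section Primitives.
Context {R : realType}.
Implicit Types (f F G : R -> R) (a b x : R).

Lemma is_derive_continuous F (f : R -> R) : (forall x, is_derive x 1 F (f x)) ->
  continuous F.
Proof.
by move=> dF x; have := dF x => ?; exact/differentiable_continuous/derivable1_diffP.
Qed.

Lemma is_derive_translate F (t c d : R) :
  is_derive (t - c) 1 F d -> is_derive t 1 (fun u => F (u - c)) d.
Proof.
move=> dF; have dc : is_derive t 1 (fun u => u - c) 1.
  by apply: is_derive_eq; rewrite subr0.
by have := @is_derive1_comp _ F (fun u => u - c) t d 1 dF dc; rewrite mulr1.
Qed.

Lemma is_derive_dilate F (c t d : R) :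
  is_derive (c * t) 1 F d -> is_derive t 1 (fun u => F (c * u)) (d * c).
Proof.
move=> dF; have dc : is_derive t 1 (fun u => c * u) c.
  by apply: is_derive_eq; rewrite /GRing.scale /= mulr1.
exact: (@is_derive1_comp _ F (fun u => c * u) t d c dF dc).
Qed.

Lemma is_derive_bigsum n (h : 'I_n -> R -> R) (dh : 'I_n -> R) (t : R) :
  (forall k, is_derive t 1 (h k) (dh k)) ->
  is_derive t 1 (fun u => \sum_(k < n) h k u) (\sum_(k < n) dh k).
Proof.
move=> /is_derive_sum; congr (is_derive _ _ _ _).
by apply/funext => u; rewrite fct_sumE.
Qed.

Lemma MVT_le F f a b : a <= b ->
  (forall x, a <= x <= b -> is_derive x 1 F (f x)) ->
  exists2 c, a <= c <= b & F b - F a = f c * (b - a).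
Proof.
move=> ab dF; have [] := @MVT_segment R F f a b ab.
- by move=> x; rewrite in_itv /= => /andP[ax xb]; apply: dF; rewrite !ltW.
- apply: derivable_within_continuous => x; rewrite in_itv /= => xab.
  by have := dF x xab => ?.
- by move=> c; rewrite in_itv /=; exists c.
Qed.

Lemma ge0_derive_le F f a b : a <= b ->
  (forall x, a <= x <= b -> is_derive x 1 F (f x)) ->
  (forall x, a <= x <= b -> 0 <= f x) -> F a <= F b.
Proof.
move=> ab dF f0; have [c cab E] := MVT_le ab dF.
by rewrite -subr_ge0 E mulr_ge0 ?f0 // subr_ge0.
Qed.

Lemma norm_derive_le F f a b M : a <= b ->
  (forall x, a <= x <= b -> is_derive x 1 F (f x)) ->
  (forall x, a <= x <= b -> `|f x| <= M) -> `|F b - F a| <= M * (b - a).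
Proof.
move=> ab dF fM; have [c cab ->] := MVT_le ab dF.
have ba : 0 <= b - a by rewrite subr_ge0.
by rewrite normrM (ger0_norm ba) ler_wpM2r // fM.
Qed.

(** The derivatives are prescribed on a half-line so that the lemma applies to the primitives of
    [primitive_itvoy]; [Num.min] leaves the order of [a] and [b] free. *)
Lemma eq_derive_sub F G f a b :
  (forall x, Num.min a b <= x -> is_derive x 1 F (f x)) ->
  (forall x, Num.min a b <= x -> is_derive x 1 G (f x)) -> F b - F a = G b - G a.
Proof.
wlog ab : a b / a <= b.
  move=> H dF dG; have [ab|/ltW ba] := leP a b; first exact: H.
  have E : F a - F b = G a - G b by apply: H; rewrite // minC.
  by rewrite -opprB E opprB.
rewrite (min_idPl ab) => dF dG.
have [x /andP[ax _]|c _ ] := @MVT_le (F - G) (cst 0) a b ab.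
  have := dF x ax => dFx; have := dG x ax => dGx.
  by apply: is_derive_eq; rewrite subrr.
rewrite mul0r /= => /eqP.
by rewrite !fctE subr_eq0 => /eqP; lra.
Qed.

Lemma primitive_itvoy f a : continuous f ->
  exists F, forall x, a < x -> is_derive x 1 F (f x).
Proof.
move=> cf.
exists (fun x => (\int[lebesgue_measure]_(t in [set` `[a, x]]) f t)%R).
move=> x ax.
have [||||dF FE] := @continuous_FTC1_closed R f a x (x + 1).
- by rewrite ltrDl.
- apply: continuous_compact_integrable; first exact: segment_compact.
  exact/continuous_subspaceT.
- by [].
- exact: cf.
by rewrite -FE derive1E; apply/derivableP.
Qed.

(** Glues the half-line primitives. The base point $-(|x|+1)$ varies with $x$, but subtracting the
    value at 0 makes the result independent of it; near $x$ the fixed base point $-(|x|+2)$ gives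
    the same function. *)
Lemma primitive f : continuous f -> exists F, forall x, is_derive x 1 F (f x).
Proof.
move=> cf.
pose P a := sval (cid (primitive_itvoy a cf)).
have dP a x : a < x -> is_derive x 1 (P a) (f x).
  by rewrite /P; case: cid => F /= dF; apply: dF.
exists (fun x => P (- (`|x| + 1)) x - P (- (`|x| + 1)) 0) => x.
apply: (@near_eq_is_derive _ _ _ (fun y => P (- (`|x| + 2)) y - P (- (`|x| + 2)) 0)).
  near=> y; apply/esym.
  have yx : `|y| < `|x| + 1.
    have yx : `|x - y| < 1 by near: y; apply: nbhsx_ballx.
    rewrite (_ : y = x - (x - y)); last by ring.
    by rewrite (le_lt_trans (ler_normB _ _)) // ltrD2l.
  have nx : 0 <= `|x| by [].
  have ny : - `|y| <= y by rewrite lerNl -normrN ler_norm.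
  have ny0 : 0 <= `|y| by [].
  have m0 : - `|y| <= Num.min 0 y by rewrite le_min ny oppr_le0 ny0.
  by apply: (@eq_derive_sub _ _ f) => z mz; apply: dP; lra.
have dx : is_derive x 1 (P (- (`|x| + 2))) (f x).
  apply: dP; have : - `|x| <= x by rewrite lerNl -normrN ler_norm.
  by lra.
by apply: is_derive_eq; rewrite subr0.
Unshelve. all: by end_near. Qed.

(** A total choice, with default [f] itself when no primitive exists; by [integP], any known
    primitive computes [integ]. *)
Definition prim f : R -> R := xget f [set F | forall x, is_derive x 1 F (f x)].

Definition integ f a b : R := prim f b - prim f a.

Lemma is_derive_primE F f : (forall x, is_derive x 1 F (f x)) ->
  forall x, is_derive x 1 (prim f) (f x).
Proof. by move=> dF; exact: (@xgetI _ f [set F | forall x, is_derive x 1 F (f x)] F). Qed.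

Lemma is_derive_prim f : continuous f -> forall x, is_derive x 1 (prim f) (f x).
Proof. by move=> /primitive[F]; exact: is_derive_primE. Qed.

Lemma integP F f a b : (forall x, is_derive x 1 F (f x)) ->
  integ f a b = F b - F a.
Proof.
by move=> dF; apply: (@eq_derive_sub (prim f) F f) => x _ //; exact: is_derive_primE.
Qed.

Lemma integ0 a b : integ (fun=> 0) a b = 0.
Proof.
have d0 x : is_derive x 1 (fun=> 0 : R) 0 by exact: is_derive_cst.
by rewrite (integP a b d0) subrr.
Qed.

Lemma integD f g a b : continuous f -> continuous g ->
  integ (fun x => f x + g x) a b = integ f a b + integ g a b.
Proof.
move=> /is_derive_prim df /is_derive_prim dg.
have dfg x : is_derive x 1 (prim f + prim g) (f x + g x).
  by have := df x => ?; have := dg x => ?; exact: is_deriveD.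
by rewrite (integP _ _ dfg) !fctE /integ; ring.
Qed.

Lemma integZ c f a b : continuous f ->
  integ (fun x => c * f x) a b = c * integ f a b.
Proof.
move=> /is_derive_prim df.
have dcf x : is_derive x 1 (c *: prim f) (c * f x).
  by have := df x => ?; exact: is_deriveZ.
by rewrite (integP _ _ dcf) !fctE /integ -mulrBr.
Qed.

Lemma integ_ge0 f a b : a <= b -> continuous f ->
  (forall x, a <= x <= b -> 0 <= f x) -> 0 <= integ f a b.
Proof.
move=> ab /is_derive_prim df f0; rewrite subr_ge0.
by apply: (@ge0_derive_le _ f) => // x _; exact: df.
Qed.

Lemma integ_norm_le f a b M : a <= b -> continuous f ->
  (forall x, a <= x <= b -> `|f x| <= M) -> `|integ f a b| <= M * (b - a).
Proof.
by move=> ab /is_derive_prim df fM; apply: norm_derive_le fM => // x _; exact: df.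
Qed.

(** The derivative of $F(x)e^{-cx}$ is $(f-cF)e^{-cx}\le 0$; [G] is the opposite of this
    function. *)
Lemma gronwall F f (c t : R) : 0 <= t ->
  (forall x, 0 <= x -> is_derive x 1 F (f x)) ->
  (forall x, 0 <= x -> f x <= c * F x) -> F t <= F 0 * expR (c * t).
Proof.
move=> t0 dF fF.
pose G x := - (F x * expR (- (c * x))).
pose g x := (c * F x - f x) * expR (- (c * x)).
have dG x : 0 <= x -> is_derive x 1 G (g x).
  move=> x0; have := dF x x0 => dFx.
  have dE : is_derive x 1 (fun x => expR (- (c * x))) (expR (- (c * x)) * - (c * 1)).
    by apply: is_derive1_comp.
  by apply: is_derive_eq; rewrite /g /GRing.scale /=; ring.
have : G 0 <= G t.
  apply: (@ge0_derive_le G g 0 t t0) => x /andP[x0 _]; first exact: dG.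
  by rewrite mulr_ge0 ?expR_ge0 // subr_ge0 fF.
rewrite /G lerN2 mulr0 oppr0 expR0 mulr1 expRN.
by rewrite ler_pdivrMr ?expR_gt0.
Qed.

End Primitives.

(** * The delay kernel *)

Lemma continuous_mul {R : realType} (f g : R -> R) :
  continuous f -> continuous g -> continuous (fun x => f x * g x).
Proof. by move=> cf cg x; apply: (@continuousM _ _ f g x (cf x) (cg x)). Qed.

Lemma continuous_add {R : realType} (f g : R -> R) :
  continuous f -> continuous g -> continuous (fun x => f x + g x).
Proof. by move=> cf cg x; apply: (@continuousD _ _ _ f g x (cf x) (cg x)). Qed.

(** The convention $f_{-1}=0$ lets $q_j'=q_{j-1}$ and $L_j'=-L_{j-1}$ be stated uniformly in $j$. *)
Definition prev {T : zmodType} (f : nat -> T) (j : nat) : T :=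
  if j is j'.+1 then f j' else 0.

Lemma sum_prev {R : comNzRingType} N (x y : nat -> R) :
  \sum_(j < N.+1) x j * prev y j = \sum_(j < N) x j.+1 * y j.
Proof. by rewrite big_ord_recl /= mulr0 add0r. Qed.

Lemma sum_next {R : comNzRingType} N (x y : nat -> R) :
  \sum_(j < N.+1) x j.+1 * y j
  = x N.+1 * y N + \sum_(j < N.+1) x j * prev y j.
Proof. by rewrite big_ord_recr sum_prev addrC. Qed.

Section Kernel.
Context {R : realType} (N : nat) (tau : R) (beta b : nat -> R) (q : nat -> R -> R).
Hypothesis tau_gt0 : 0 < tau.
Hypothesis dq : forall j (v : R), is_derive v 1 (q j) (prev (q ^~ v) j).
Hypothesis q0 : forall j, q j 0 = beta j.
Hypothesis qtau : forall j, q j (- tau) = - b j.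
Hypothesis beta_gt : forall j, (N < j)%N -> beta j = 0.
Hypothesis b_top : b N.+1 = 1.
Hypothesis b_gt : forall j, (N.+1 < j < 2 * N.+1)%N -> b j = 0.

(** The Gram matrix of the $q_j$ in $L^2(-\tau,0)$; in this section $n=N+1$. *)
Definition gram i j : R := integ (fun v => q i v * q j v) (- tau) 0.

Lemma kernel_continuous j : continuous (q j).
Proof. exact: is_derive_continuous (dq j). Qed.

Let cq := kernel_continuous.

Lemma gramC i j : gram i j = gram j i.
Proof. by congr (integ _ _ _); apply/funext => v; rewrite mulrC. Qed.

(** Integrate $(q_iq_j)'$ over $[-\tau,0]$; the right-hand side is the boundary term. *)
Lemma gram_prev i j :
  prev (gram ^~ j) i + prev (gram i) j = beta i * beta j - b i * b j.
Proof.
have dqq (v : R) : is_derive v 1 (fun v => q i v * q j v)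
    (prev (q ^~ v) i * q j v + q i v * prev (q ^~ v) j).
  have := dq i v => ?; have := dq j v => ?.
  by apply: is_derive_eq; rewrite /GRing.scale /=; ring.
have := integP (- tau) 0 dqq.
rewrite !q0 !qtau mulrNN => <-.
case: i j {dqq} => [|i] [|j]; rewrite /gram /=.
- rewrite addr0 -[LHS](integ0 (- tau) 0).
  by congr (integ _ _ _); apply/funext => v; rewrite mul0r mulr0 addr0.
- by rewrite add0r; congr (integ _ _ _); apply/funext => v; rewrite mul0r add0r.
- by rewrite addr0; congr (integ _ _ _); apply/funext => v; rewrite mulr0 addr0.
- by rewrite integD //; exact: continuous_mul.
Qed.

(** For $n<m<2n$ both boundary values of $q_m$ vanish, so [gram_prev] trades $(m-1,j)$ for $(m,j-1)$
    up to sign. The sum of the indices is preserved, and the descent stops at $j=0$. *)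
Lemma gram_high m j : (N.+1 < m)%N -> (m + j < 2 * N.+1)%N ->
  gram m.-1 j = 0.
Proof.
have beta_b k : (N.+1 < k < 2 * N.+1)%N -> beta k = 0 /\ b k = 0.
  by move=> Nk; rewrite beta_gt ?b_gt //; lia.
elim: j m => [|j IHj] [//|m] Nm mj /=.
  have := gram_prev m.+1 0; rewrite /= addr0 => ->.
  by have [|-> ->] := beta_b m.+1; [lia|rewrite !mul0r subrr].
have := gram_prev m.+1 j.+1; rewrite /= [gram m.+1 j](IHj m.+2) ?addr0; [|lia..].
by move=> ->; have [|-> ->] := beta_b m.+1; [lia|rewrite !mul0r subrr].
Qed.

(* Integrating by parts, only the boundary term - q N.+1 (- tau) * q j (- tau)
   survives: the later q m vanish at both ends for m < 2n. *)
Lemma gram_last j : (j < N.+1)%N -> gram N j = - b j.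
Proof.
move=> jN; have := gram_prev N.+1 j; rewrite /= beta_gt // mul0r sub0r b_top mul1r => <-.
case: j jN => [|j] jN; first by rewrite addr0.
by rewrite /= (@gram_high N.+2) ?addr0 // mul2n -addnn addSnnS ltn_add2l.
Qed.

(* For a root x + iy of the shifted quasipolynomial, xs k + i ys k is its k-th
   power and r1 + i r2 is Q(D) applied to z minus its Taylor polynomial of
   degree N at 0, where z v = exp ((x + iy) v). *)
Section NoRoot.
Context (x y : R) (xs ys : nat -> R) (r1 r2 : R -> R).
Hypothesis dr1 : forall v : R, is_derive v 1 r1 (x * r1 v - y * r2 v + xs N.+1 * q N v).
Hypothesis dr2 : forall v : R, is_derive v 1 r2 (x * r2 v + y * r1 v + ys N.+1 * q N v).
Hypothesis r1_0 : r1 0 = 0.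
Hypothesis r2_0 : r2 0 = 0.
Hypothesis r1_tau : r1 (- tau) = - xs N.+1.
Hypothesis r2_tau : r2 (- tau) = - ys N.+1.
Hypothesis x_ge0 : 0 <= x.
Hypothesis xy_neq0 : 0 < x ^+ 2 + y ^+ 2.

Let cr1 : continuous r1 := is_derive_continuous dr1.
Let cr2 : continuous r2 := is_derive_continuous dr2.
Let ell1 j := integ (fun v => r1 v * q j v) (- tau) 0.
Let ell2 j := integ (fun v => r2 v * q j v) (- tau) 0.

(** Integrate $(r_iq_j)'$ over $[-\tau,0]$. By [gram_last], the boundary term at $-\tau$ cancels
    against the forcing term in $q_N$. *)
Let ell_prev j : (j < N.+1)%N ->
  x * ell1 j - y * ell2 j + prev ell1 j = 0
  /\ x * ell2 j + y * ell1 j + prev ell2 j = 0.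
Proof.
(* One computation serves twice: $(s,t)$ is $(x,-y)$ for the real part and $(x,y)$ for the imaginary
   part. *)
have step (s t : R) (f g : R -> R) c : 
    (forall v : R, is_derive v 1 f (s * f v + t * g v + c * q N v)) ->
    continuous f -> continuous g -> f 0 = 0 -> f (- tau) = - c -> (j < N.+1)%N ->
    s * integ (fun v => f v * q j v) (- tau) 0
    + t * integ (fun v => g v * q j v) (- tau) 0
    + prev (fun j => integ (fun v => f v * q j v) (- tau) 0) j = 0.
  move=> df cf cg f0 ft jN.
  have dfq (v : R) : is_derive v 1 (fun v => f v * q j v)
    (s * (f v * q j v) + t * (g v * q j v) + c * (q N v * q j v) + f v * prev (q ^~ v) j).
    have := df v => ?; have := dq j v => ?.
    by apply: is_derive_eq; rewrite /GRing.scale /=; ring.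
  have := integP (- tau) 0 dfq.
  have cp : continuous (fun v => f v * prev (q ^~ v) j).
    by apply: continuous_mul => //; case: (j) => // v; exact: cst_continuous.
  have cc (u : R) : continuous (fun _ : R => u) by move=> v; exact: cst_continuous.
  have cm (u : R) (h k : R -> R) : continuous h -> continuous k ->
      continuous (fun v : R => u * (h v * k v)).
    by move=> ch ck; do ! apply: continuous_mul.
  have cf1 := cm s _ _ cf (@cq j); have cf2 := cm t _ _ cg (@cq j).
  have cf3 := cm c _ _ (@cq N) (@cq j).
  rewrite integD //; last by do ! apply: continuous_add.
  rewrite integD //; last by apply: continuous_add.
  rewrite integD // !integZ //; do ?[exact: continuous_mul].
  rewrite -[X in _ + c * X + _]/(gram N j) gram_last // f0 ft qtau.
  have -> : integ (fun v => f v * prev (q ^~ v) j) (- tau) 0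
    = prev (fun j => integ (fun v => f v * q j v) (- tau) 0) j.
    case: (j) => //=; rewrite -[RHS](integ0 (- tau) 0).
    by congr (integ _ _ _); apply/funext => v; rewrite mulr0.
  by move=> /eqP; rewrite -subr_eq0 => /eqP E; rewrite -[RHS]E; ring.
move=> jN; split.
  by rewrite -mulNr; apply: (step x (- y) r1 r2 (xs N.+1)) => // v; rewrite mulNr.
exact: (step x y r2 r1 (ys N.+1)).
Qed.

(** With $\ell_j=$ [ell1 j] $+\,i$ [ell2 j], the recurrence reads $(x+iy)\ell_j=-\ell_{j-1}$, and
    $x+iy\neq0$. *)
Let ell0 j : (j < N.+1)%N -> ell1 j = 0 /\ ell2 j = 0.
Proof.
have solve (u v : R) : x * u - y * v = 0 -> x * v + y * u = 0 -> u = 0 /\ v = 0.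
  move=> e1 e2.
  have eu : (x ^+ 2 + y ^+ 2) * u = 0.
    transitivity (x * (x * u - y * v) + y * (x * v + y * u)); first by ring.
    by rewrite e1 e2 !mulr0 addr0.
  have ev : (x ^+ 2 + y ^+ 2) * v = 0.
    transitivity (x * (x * v + y * u) - y * (x * u - y * v)); first by ring.
    by rewrite e1 e2 !mulr0 subr0.
  by move: eu ev => /eqP + /eqP; rewrite !mulf_eq0 gt_eqF //= => /eqP -> /eqP ->.
elim: j => [|j IHj] jN; have [e1 e2] := ell_prev jN.
  by apply: solve; move: e1 e2; rewrite /= !addr0.
have [p1 p2] := IHj (ltnW jN).
by apply: solve; move: e1 e2; rewrite /= p1 p2 !addr0.
Qed.

(** Integrating the derivative of $r_1^2+r_2^2$ gives $-(x_n^2+y_n^2)=2x\int(r_1^2+r_2^2)$ with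
    $x_n=$ [xs N.+1] and $y_n=$ [ys N.+1], because the cross terms are [ell1 N] and [ell2 N]. The
    two sides have opposite signs. *)
Lemma kernel_no_root : xs N.+1 = 0 /\ ys N.+1 = 0.
Proof.
have dr (v : R) : is_derive v 1 (fun v => r1 v * r1 v + r2 v * r2 v)
   (2 * x * (r1 v * r1 v + r2 v * r2 v)
    + (2 * xs N.+1 * (r1 v * q N v) + 2 * ys N.+1 * (r2 v * q N v))).
  have := dr1 v => ?; have := dr2 v => ?.
  by apply: is_derive_eq; rewrite /GRing.scale /=; ring.
have := integP (- tau) 0 dr.
have cc (u : R) : continuous (fun _ : R => u) by move=> v; exact: cst_continuous.
have c1 := continuous_mul cr1 cr1; have c2 := continuous_mul cr2 cr2.
have c3 := continuous_mul cr1 (@cq N); have c4 := continuous_mul cr2 (@cq N).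
have c5 := continuous_add c1 c2.
have c6 := continuous_mul (cc (2 * xs N.+1)) c3.
have c7 := continuous_mul (cc (2 * ys N.+1)) c4.
rewrite integD; [|exact: continuous_mul|exact: continuous_add].
rewrite (integZ (2 * x) _ _ c5) (integD _ _ c6 c7).
rewrite (integZ _ _ _ c3) (integZ _ _ _ c4).
have [e1 e2] := ell0 (ltnSn N).
rewrite -/(ell1 N) -/(ell2 N) e1 e2 r1_0 r2_0 r1_tau r2_tau.
have : 0 <= integ (fun v => r1 v * r1 v + r2 v * r2 v) (- tau) 0.
  apply: integ_ge0 => //; first by rewrite oppr_le0 ltW.
  by move=> v _; rewrite addr_ge0 // -expr2 sqr_ge0.
set I := integ _ _ _ => I0 E.
have : 0 <= 2 * x * I by rewrite mulr_ge0 ?mulr_ge0.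
have := sqr_ge0 (xs N.+1); have := sqr_ge0 (ys N.+1).
move=> y2 x2 h.
have : xs N.+1 ^+ 2 = 0 /\ ys N.+1 ^+ 2 = 0 by split; lra.
by move=> [/eqP + /eqP]; rewrite !sqrf_eq0 => /eqP -> /eqP ->.
Qed.

End NoRoot.
End Kernel.

(** * Growth of solutions *)

(** Expanding $\epsilon c_{k+1}(\epsilon x_k-x_{k+1})^2\ge0$ bounds the $k$-th cross term by
    $\epsilon(c_kx_k^2+c_{k+1}x_{k+1}^2)$. Each square is used at most twice, the last one once. *)
Lemma weighted_chain {R : realFieldType} (eps : R) m (c x : nat -> R) :
  0 < eps -> (forall k, 0 <= c k) ->
  (forall k, (k < m)%N -> c k = eps ^+ 2 * c k.+1) ->
  \sum_(k < m) c k * (2 * (x k * x k.+1))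
  <= 2 * eps * (\sum_(k < m) c k * x k ^+ 2) + eps * (c m * x m ^+ 2).
Proof.
move=> eps0 c0; elim: m => [|m IHm] cE.
  by rewrite !big_ord0 mulr0 add0r; apply: mulr_ge0; [exact: ltW|apply: mulr_ge0; rewrite ?sqr_ge0].
rewrite !big_ord_recr /=.
have /IHm := fun k (km : (k < m)%N) => cE k (leqW km).
have := cE m (ltnSn m).
set s1 := \sum_(_ < m) _; set s2 := \sum_(_ < m) _ => cm s12.
have : 0 <= eps * c m.+1 * (eps * x m - x m.+1) ^+ 2.
  by rewrite mulr_ge0 ?sqr_ge0 // mulr_ge0 // ltW.
have -> : eps * c m.+1 * (eps * x m - x m.+1) ^+ 2 = eps * (c m * x m ^+ 2)
   + eps * (c m.+1 * x m.+1 ^+ 2) - c m * (2 * (x m * x m.+1)) by rewrite cm; ring.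
move=> h; rewrite mulrDr; move: s12 h; lra.
Qed.

(** Mirror image of [weighted_chain], for cross terms that look back and weights that decrease with
    the index when $\epsilon<1$. *)
Lemma weighted_chain_prev {R : realFieldType} (eps : R) m (d x : nat -> R) :
  0 < eps -> (forall k, 0 <= d k) -> (forall k, d k.+1 = eps ^+ 2 * d k) ->
  \sum_(k < m.+1) d k * (2 * (x k * - prev x k))
  <= 2 * eps * (\sum_(k < m) d k * x k ^+ 2) + eps * (d m * x m ^+ 2).
Proof.
move=> eps0 d0 dE; elim: m => [|m IHm].
  rewrite big_ord_recl !big_ord0 /= oppr0 !mulr0 addr0 add0r.
  by apply: mulr_ge0; [exact: ltW|apply: mulr_ge0; rewrite ?sqr_ge0].
rewrite big_ord_recr [X in _ * X + _]big_ord_recr /=; move: IHm.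
set s1 := \sum_(_ < m.+1) _; set s2 := \sum_(_ < m) _ => s12.
have : 0 <= eps * d m * (eps * x m.+1 + x m) ^+ 2.
  by rewrite mulr_ge0 ?sqr_ge0 // mulr_ge0 // ltW.
have -> : eps * d m * (eps * x m.+1 + x m) ^+ 2 = eps * (d m.+1 * x m.+1 ^+ 2)
   + eps * (d m * x m ^+ 2) - d m.+1 * (2 * (x m.+1 * - x m)) by rewrite dE; ring.
move=> h; rewrite mulrDr; move: s12 h; lra.
Qed.

(** Bounds the Lyapunov function at time 0 in units of $M^2$, where $M$ bounds the initial history:
    [K1] times $M$ bounds the residual, and the three summands bound $E$, the $Z_k^2$ and the
    $L_k^2$. It does not involve the solution, which makes the growth estimate uniform. *)
Definition energy_const {R : realType} (N : nat) (tau Qb eps : R) (beta : nat -> R) : R :=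
  let K1 := \sum_(k < N.+1) `|beta k| + N.+1%:R * Qb in
  K1 ^+ 2 * tau + \sum_(k < N.+1) (eps ^+ 2) ^+ (N.+1 - k) / 2
  + \sum_(k < N.+1) (eps ^+ 2) ^+ k / eps ^+ (2 * N).+1 * (K1 * Qb * tau) ^+ 2.

(** * The energy identity along a solution *)

Section Energy.
Context {R : realType} (N : nat) (tau : R) (beta b : nat -> R) (q : nat -> R -> R).
Hypothesis tau_gt0 : 0 < tau.
Hypothesis dq : forall j (v : R), is_derive v 1 (q j) (prev (q ^~ v) j).
Hypothesis q0 : forall j, q j 0 = beta j.
Hypothesis qtau : forall j, q j (- tau) = - b j.
Hypothesis beta_gt : forall j, (N < j)%N -> beta j = 0.
Hypothesis b_top : b N.+1 = 1.
Hypothesis b_gt : forall j, (N.+1 < j < 2 * N.+1)%N -> b j = 0.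

Context (Z : nat -> R -> R).
Hypothesis dZ : forall k (t : R), (k <= N)%N -> is_derive t 1 (Z k) (Z k.+1 t).

Let w (t : R) := \sum_(k < N.+1) beta k * Z k t.

Hypothesis dde : forall t, 0 <= t ->
  Z N.+1 t + \sum_(k < N.+1) b k * Z k t + w (t - tau) = 0.

Let G := gram tau q.
Let cq j : continuous (q j).
Proof. exact: (is_derive_continuous (dq j)). Qed.

Let cw : continuous w.
Proof.
apply: (@is_derive_continuous _ _ (fun t => \sum_(k < N.+1) beta k * Z k.+1 t)) => t.
apply: is_derive_bigsum => k; have := dZ t (ltn_ord k) => ?.
exact: is_deriveZ.
Qed.

(** Iterated primitives of $w=Q(D)Z$ make the moments of $w$ against the $q_j$ explicit. *)
Let wp i : R -> R := iter i prim w.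

Let dwp i (t : R) : is_derive t 1 (wp i.+1) (wp i t).
Proof.
apply: is_derive_prim; elim: i => [|i IHi]; first exact: cw.
exact/is_derive_continuous/is_derive_prim.
Qed.

(* Iterated integration by parts: a primitive of [wp s * q j (_ - t)]. *)
Fixpoint parts (t : R) (s j : nat) (u : R) : R :=
  wp s.+1 u * q j (u - t) - (if j is j'.+1 then parts t s.+1 j' u else 0).

Let dparts t s j (u : R) :
  is_derive u 1 (parts t s j) (wp s u * q j (u - t)).
Proof.
have dqu i : is_derive u 1 (fun u => q i (u - t)) (prev (q ^~ (u - t)) i).
  exact: is_derive_translate.
elim: j s => [|j IHj] s; have := dwp s u => ?.
  have := dqu 0%N => ?.
  by apply: is_derive_eq; rewrite /GRing.scale /=; ring.
have := dqu j.+1 => ?; have := IHj s.+1 => ?.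
by apply: is_derive_eq; rewrite /GRing.scale /=; ring.
Qed.

Let W j t := parts t 0 j t - parts t 0 j (t - tau).

(** The increment of [parts t s j] over $[t-\tau,t]$, with $q_j(0)$ and $q_j(-\tau)$ replaced by the
    constants $\beta_j$ and $-b_j$; in this form $t$ enters only through the primitives of $w$. *)
Fixpoint bdry (s j : nat) (t : R) : R :=
  beta j * wp s.+1 t + b j * wp s.+1 (t - tau)
  - (if j is j'.+1 then bdry s.+1 j' t else 0).

Let WE j t : W j t = bdry 0 j t.
Proof.
rewrite /W; move: 0%N; elim: j => [|j IHj] s /=.
  by rewrite subrr q0 (_ : t - tau - t = - tau) ?qtau; ring.
by rewrite -IHj subrr q0 (_ : t - tau - t = - tau) ?qtau; ring.
Qed.

(** Differentiation lowers [s] by one in every term, so that the tail of the recursion reassembles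
    into [bdry] at the preceding [j] and the original [s]. *)
Let dbdry s j (t : R) : is_derive t 1 (bdry s j)
  (beta j * wp s t + b j * wp s (t - tau) - prev (fun j => bdry s j t) j).
Proof.
have dws i : is_derive t 1 (fun t => wp i.+1 (t - tau)) (wp i (t - tau)).
  exact: is_derive_translate.
elim: j s => [|j IHj] s.
  have := dwp s t => ?; have := dws s => ?.
  by apply: is_derive_eq; rewrite /GRing.scale /=; ring.
have := dwp s t => ?; have := dws s => ?; have := IHj s.+1 => ?.
apply: is_derive_eq; rewrite /GRing.scale /=.
by case: (j) => [|k] /=; ring.
Qed.

Let dW j (t : R) : is_derive t 1 (W j)
  (beta j * w t + b j * w (t - tau) - prev (fun j => W j t) j).
Proof.
have -> : W j = bdry 0 j by apply/funext => s; rewrite WE.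
have -> : prev (fun j => W j t) j = prev (fun j => bdry 0 j t) j.
  by case: j => //= j; rewrite WE.
exact: dbdry.
Qed.

Let F := prim (fun u => w u * w u).

Let dF (u : R) : is_derive u 1 F (w u * w u).
Proof. exact: (is_derive_prim (continuous_mul cw cw)). Qed.

Let Y i t := \sum_(j < N.+1) Z j t * G i j.

(* E t is the integral over [t - tau, t] of res t ^ 2, and L j t that of
   res t * q j (_ - t), where res t is Q(D) applied to Z 0 minus its Taylor
   polynomial of degree N at t (lemmas EE and LE below); these expanded forms
   can be differentiated in t. *)
Let E t := F t - F (t - tau) - 2 * (\sum_(j < N.+1) Z j t * W j t)
  + \sum_(i < N.+1) Z i t * Y i t.

Let L j t := W j t - Y j t.

Let dY i (t : R) : is_derive t 1 (Y i) (\sum_(j < N.+1) Z j.+1 t * G i j).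
Proof.
apply: is_derive_bigsum => j; have := dZ t (ltn_ord j) => ?.
by apply: is_derive_eq; rewrite /GRing.scale /=; ring.
Qed.

Let YN t : Y N t = - \sum_(k < N.+1) b k * Z k t.
Proof.
rewrite -sumrN; apply: eq_bigr => k _.
by rewrite /G (gram_last tau_gt0 dq q0 qtau beta_gt b_top b_gt) // mulrN mulrC.
Qed.

Let prevY t j : prev (Y ^~ t) j = \sum_(i < N.+1) Z i t * prev (G ^~ i) j.
Proof. by case: j => //=; rewrite big1 // => i _; rewrite mulr0. Qed.

(** Symmetrising the double sum in $i$ and $j$ brings in [gram_prev], whose right-hand side splits
    into two squares of linear forms in the $Z_j$. *)
Let sum_prevY t : 2 * (\sum_(j < N.+1) Z j t * prev (Y ^~ t) j)
  = w t ^+ 2 - (\sum_(k < N.+1) b k * Z k t) ^+ 2.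
Proof.
have QE : \sum_(j < N.+1) Z j t * prev (Y ^~ t) j
    = \sum_(j < N.+1) \sum_(i < N.+1) Z j t * Z i t * prev (G ^~ i) j.
  by apply: eq_bigr => j _; rewrite prevY mulr_sumr; apply: eq_bigr => i _; rewrite mulrA.
have QE' : \sum_(j < N.+1) Z j t * prev (Y ^~ t) j
    = \sum_(j < N.+1) \sum_(i < N.+1) Z j t * Z i t * prev (G j) i.
  rewrite QE exchange_big /=; apply: eq_bigr => j _; apply: eq_bigr => i _.
  rewrite (mulrC (Z i t)); congr (_ * _).
  by case: (nat_of_ord i) => //= k; rewrite /G gramC.
rewrite mulr_natl mulr2n {1}QE QE' -big_split /=.
rewrite !expr2 !big_distrlr /= -sumrB; apply: eq_bigr => j _.
rewrite -big_split -sumrB; apply: eq_bigr => i _ /=.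
by rewrite -mulrDr (gram_prev dq q0 qtau); ring.
Qed.

(** [sum_next] isolates the top-order terms. The terms in [prev] of $W$ cancel, [sum_prevY] leaves a
    difference of squares, and the delay equation eliminates $\sum_k b_kZ_k$. *)
Let dE (t : R) : 0 <= t -> is_derive t 1 E (- Z N.+1 t ^+ 2 - 2 * Z N.+1 t * L N t).
Proof.
move=> t0.
have dFt := dF t.
have dFm : is_derive t 1 (fun t => F (t - tau)) (w (t - tau) * w (t - tau)).
  exact: is_derive_translate.
have dZW : is_derive t 1 (fun t => \sum_(j < N.+1) Z j t * W j t)
    (\sum_(j < N.+1) (Z j.+1 t * W j t
       + Z j t * (beta j * w t + b j * w (t - tau) - prev (fun j => W j t) j))).
  apply: is_derive_bigsum => j; have := dZ t (ltn_ord j) => ?; have := dW j t => ?.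
  by apply: is_derive_eq; rewrite /GRing.scale /=; ring.
have dZY : is_derive t 1 (fun t => \sum_(i < N.+1) Z i t * Y i t)
    (\sum_(i < N.+1) (Z i.+1 t * Y i t + Z i t * \sum_(j < N.+1) Z j.+1 t * G i j)).
  apply: is_derive_bigsum => i; have := dZ t (ltn_ord i) => ?; have := dY i t => ?.
  by apply: is_derive_eq; rewrite /GRing.scale /=; ring.
have ZYC : \sum_(i < N.+1) Z i t * (\sum_(j < N.+1) Z j.+1 t * G i j)
    = \sum_(i < N.+1) Z i.+1 t * Y i t.
  transitivity (\sum_(i < N.+1) \sum_(j < N.+1) Z i t * (Z j.+1 t * G i j)).
    by apply: eq_bigr => i _; rewrite mulr_sumr.
  rewrite exchange_big; apply: eq_bigr => j _ /=; rewrite mulr_sumr.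
  by apply: eq_bigr => i _; rewrite /G gramC; ring.
have ZW' : \sum_(j < N.+1) Z j t * (beta j * w t + b j * w (t - tau) - prev (fun j => W j t) j)
    = w t * w t + (\sum_(k < N.+1) b k * Z k t) * w (t - tau)
      - \sum_(j < N.+1) Z j t * prev (fun j => W j t) j.
  have -> : w t * w t = \sum_(j < N.+1) beta j * Z j t * w t by rewrite -mulr_suml.
  by rewrite mulr_suml -big_split -sumrB; apply: eq_bigr => j _ /=; ring.
rewrite /E; apply: is_derive_eq; rewrite !big_split /= ZYC ZW'.
have nW := sum_next N (Z ^~ t) (fun j => W j t).
have nY := sum_next N (Z ^~ t) (Y ^~ t).
rewrite nW nY YN /L YN /GRing.scale /=.
have := sum_prevY t; have := dde t0.
set B := \sum_(k < N.+1) b k * Z k t.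
set Q := \sum_(j < N.+1) Z j t * prev (Y ^~ t) j.
set V := \sum_(j < N.+1) Z j t * prev _ j.
move=> e1 e2.
have BE : B = - Z N.+1 t - w (t - tau) by rewrite -[RHS]addr0 -e1; ring.
have -> : Q = (w t ^+ 2 - B ^+ 2) / 2 by rewrite -e2; field.
by rewrite BE; field.
Qed.

(** By [gram_prev] and [gram_last], what remains beside $-L_{j-1}$ is $b_j$ times the left-hand side
    of the delay equation. *)
Let dL j (t : R) : (j <= N)%N -> 0 <= t -> is_derive t 1 (L j) (- prev (L ^~ t) j).
Proof.
move=> jN t0; have := dW j t => ?; have := dY j t => ?.
apply: is_derive_eq.
have := sum_next N (Z ^~ t) (G j) => /= ->.
have -> : \sum_(i < N.+1) Z i t * prev (G j) i
    = beta j * w t - b j * (\sum_(k < N.+1) b k * Z k t) - prev (Y ^~ t) j.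
  rewrite prevY /w !mulr_sumr -!sumrB; apply: eq_bigr => i _.
  have -> : prev (G j) i = beta j * beta i - b j * b i - prev (G ^~ i) j.
    by rewrite -(gram_prev dq q0 qtau) addrC addKr.
  by ring.
have -> : G j N = - b j by rewrite /G gramC (gram_last tau_gt0 dq q0 qtau beta_gt b_top b_gt).
have -> : prev (L ^~ t) j = prev (fun j => W j t) j - prev (Y ^~ t) j.
  by case: (j) => //=; rewrite subr0.
have := dde t0 => /eqP; rewrite addr_eq0 => /eqP e.
have -> : w (t - tau) = - (Z N.+1 t + \sum_(k < N.+1) b k * Z k t) by rewrite e opprK.
ring.
Qed.

Let res t u := w u - \sum_(j < N.+1) Z j t * q j (u - t).

Let dgram t i j (u : R) : is_derive u 1
  (fun u => prim (fun v => q i v * q j v) (u - t)) (q i (u - t) * q j (u - t)).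
Proof.
apply: is_derive_translate.
exact: (is_derive_prim (continuous_mul (@cq i) (@cq j))).
Qed.

Let gramE t i j : prim (fun v => q i v * q j v) (t - t)
  - prim (fun v => q i v * q j v) (t - tau - t) = G i j.
Proof. by rewrite subrr (_ : t - tau - t = - tau) //; ring. Qed.

Let LE t j : L j t = integ (fun u => res t u * q j (u - t)) (t - tau) t.
Proof.
pose H u := parts t 0 j u
  - \sum_(i < N.+1) Z i t * prim (fun v => q j v * q i v) (u - t).
have dH (u : R) : is_derive u 1 H (res t u * q j (u - t)).
  have d1 := dparts t 0 j u.
  have d2 : is_derive u 1
      (fun u => \sum_(i < N.+1) Z i t * prim (fun v => q j v * q i v) (u - t))
      (\sum_(i < N.+1) Z i t * (q j (u - t) * q i (u - t))).
    apply: is_derive_bigsum => i; have := dgram t j i u => ?.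
    by apply: is_derive_eq; rewrite /GRing.scale /=; ring.
  apply: is_derive_eq; rewrite /res mulrBl; congr (_ - _).
  by rewrite mulr_suml; apply: eq_bigr => i _; ring.
rewrite (integP _ _ dH) /H /L /W /Y.
under eq_bigr => i _ do rewrite -(gramE t) mulrBr.
by rewrite sumrB; ring.
Qed.

(** Shows that $E\ge0$ and allows its estimate at time 0. *)
Let EE t : E t = integ (fun u => res t u * res t u) (t - tau) t.
Proof.
pose H u := F u - 2 * (\sum_(j < N.+1) Z j t * parts t 0 j u)
  + \sum_(i < N.+1) Z i t *
      \sum_(j < N.+1) Z j t * prim (fun v => q i v * q j v) (u - t).
have dH (u : R) : is_derive u 1 H (res t u * res t u).
  have d0 := dF u.
  have d1 : is_derive u 1 (fun u => \sum_(j < N.+1) Z j t * parts t 0 j u)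
      (\sum_(j < N.+1) Z j t * (w u * q j (u - t))).
    apply: is_derive_bigsum => j; have := dparts t 0 j u => ?.
    by apply: is_derive_eq; rewrite /GRing.scale /=; ring.
  have d2 : is_derive u 1 (fun u => \sum_(i < N.+1) Z i t *
        \sum_(j < N.+1) Z j t * prim (fun v => q i v * q j v) (u - t))
      (\sum_(i < N.+1) Z i t * \sum_(j < N.+1) Z j t * (q i (u - t) * q j (u - t))).
    apply: is_derive_bigsum => i.
    have d3 : is_derive u 1
        (fun u => \sum_(j < N.+1) Z j t * prim (fun v => q i v * q j v) (u - t))
        (\sum_(j < N.+1) Z j t * (q i (u - t) * q j (u - t))).
      apply: is_derive_bigsum => j; have := dgram t i j u => ?.
      by apply: is_derive_eq; rewrite /GRing.scale /=; ring.
    by apply: is_derive_eq; rewrite /GRing.scale /=; ring.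
  rewrite /H; apply: is_derive_eq; rewrite /res /GRing.scale /=.
  set T := \sum_(j < N.+1) Z j t * q j (u - t).
  have -> : \sum_(j < N.+1) Z j t * (w u * q j (u - t)) = w u * T.
    by rewrite mulr_sumr; apply: eq_bigr => j _; ring.
  have -> : \sum_(i < N.+1) Z i t * (\sum_(j < N.+1) Z j t * (q i (u - t) * q j (u - t)))
      = T * T.
    rewrite mulr_suml; apply: eq_bigr => i _; rewrite -mulrA; congr (_ * _).
    by rewrite mulr_sumr; apply: eq_bigr => j _; ring.
  by ring.
rewrite (integP _ _ dH) /H /E.
have -> : \sum_(i < N.+1) Z i t * Y i t =
    \sum_(i < N.+1) Z i t * (\sum_(j < N.+1) Z j t * prim (fun v => q i v * q j v) (t - t))
    - \sum_(i < N.+1) Z i t * (\sum_(j < N.+1) Z j t * prim (fun v => q i v * q j v) (t - tau - t)).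
  rewrite -sumrB; apply: eq_bigr => i _; rewrite -mulrBr -sumrB; congr (_ * _).
  by apply: eq_bigr => j _; rewrite -mulrBr gramE.
have -> : \sum_(j < N.+1) Z j t * W j t = \sum_(j < N.+1) Z j t * parts t 0 j t
    - \sum_(j < N.+1) Z j t * parts t 0 j (t - tau).
  by rewrite -sumrB; apply: eq_bigr => j _; rewrite -mulrBr.
by ring.
Qed.

Let cres t : continuous (res t).
Proof.
pose g (u : R) := \sum_(j < N.+1) Z j t * q j (u - t).
have cs : continuous g.
  apply: (@is_derive_continuous _ _
    (fun u => \sum_(j < N.+1) Z j t * prev (q ^~ (u - t)) j)) => u.
  apply: is_derive_bigsum => j.
  have dj : is_derive u 1 (fun u => q j (u - t)) (prev (q ^~ (u - t)) j).
    exact: is_derive_translate.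
  exact: is_deriveZ.
have -> : res t = (fun u => w u + cst (-1) u * g u).
  by apply/funext => u; rewrite mulN1r.
apply: continuous_add => //; apply: continuous_mul => // u.
exact: cst_continuous.
Qed.

Let E_ge0 t : 0 <= E t.
Proof.
rewrite EE; apply: integ_ge0.
- by rewrite gerBl ltW.
- exact: continuous_mul.
- by move=> u _; rewrite -expr2 sqr_ge0.
Qed.

(** * The Lyapunov function and its growth *)

Section Lyapunov.
Context (eps Qb M : R).
Hypothesis eps_gt0 : 0 < eps.
Hypothesis eps_le1 : eps <= 1.
Hypothesis Qb_ge : forall j v, (j <= N)%N -> - tau <= v <= 0 -> `|q j v| <= Qb.
Hypothesis M_ge : forall k u, (k <= N)%N -> - tau <= u <= 0 -> `|Z k u| <= M.

(* With geometric weights, each cross term in the derivative of S is absorbed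
   by its two neighbours at the price of a factor eps. *)
Let c k := (eps ^+ 2) ^+ (N.+1 - k) / 2.
Let d k := (eps ^+ 2) ^+ k / eps ^+ (2 * N).+1.

Let c_ge0 k : 0 <= c k.
Proof. by rewrite divr_ge0 // exprn_ge0 // sqr_ge0. Qed.

Let d_ge0 k : 0 <= d k.
Proof. by rewrite divr_ge0 // exprn_ge0 ?sqr_ge0 // ltW. Qed.

Let S t := E t + \sum_(k < N.+1) c k * Z k t ^+ 2 + \sum_(k < N.+1) d k * L k t ^+ 2.

Let dS (t : R) : 0 <= t -> is_derive t 1 S (- Z N.+1 t ^+ 2 - 2 * Z N.+1 t * L N t
  + \sum_(k < N.+1) c k * (2 * (Z k t * Z k.+1 t))
  + \sum_(k < N.+1) d k * (2 * (L k t * - prev (L ^~ t) k))).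
Proof.
move=> t0; have := dE t0 => ?.
have dc : is_derive t 1 (fun t => \sum_(k < N.+1) c k * Z k t ^+ 2)
    (\sum_(k < N.+1) c k * (2 * (Z k t * Z k.+1 t))).
  apply: is_derive_bigsum => k; have := dZ t (ltn_ord k) => ?.
  by apply: is_derive_eq; rewrite /GRing.scale /=; ring.
have dd : is_derive t 1 (fun t => \sum_(k < N.+1) d k * L k t ^+ 2)
    (\sum_(k < N.+1) d k * (2 * (L k t * - prev (L ^~ t) k))).
  apply: is_derive_bigsum => k; have := dL (leq_ord k) t0 => ?.
  by apply: is_derive_eq; rewrite /GRing.scale /=; ring.
exact: is_deriveD.
Qed.

(** The weights are normalised by $c_{N+1}=1/2$ and $\epsilon d_N=1$, so the chains leave
    $\frac{\epsilon}{2}Z_{N+1}^2+L_N^2$ at their ends. From $(Z_{N+1}+2L_N)^2\ge0$ follows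
    $-Z_{N+1}^2-2Z_{N+1}L_N\le-\frac12Z_{N+1}^2+2L_N^2$; the resulting $3L_N^2$ fits into $4\epsilon
    d_NL_N^2$. *)
Let dS_le t : - Z N.+1 t ^+ 2 - 2 * Z N.+1 t * L N t
  + \sum_(k < N.+1) c k * (2 * (Z k t * Z k.+1 t))
  + \sum_(k < N.+1) d k * (2 * (L k t * - prev (L ^~ t) k)) <= 4 * eps * S t.
Proof.
have cE k : (k < N.+1)%N -> c k = eps ^+ 2 * c k.+1.
  by move=> kN; rewrite /c subSn // exprS mulrA.
have dEE k : d k.+1 = eps ^+ 2 * d k by rewrite /d exprS mulrA.
have := weighted_chain (Z ^~ t) eps_gt0 c_ge0 cE.
have := weighted_chain_prev N (L ^~ t) eps_gt0 d_ge0 dEE.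
have -> : c N.+1 = 1 / 2 by rewrite /c subnn.
have dN : eps * d N = 1.
  by rewrite /d -exprM mulrA -exprS mulfV // expf_neq0 // gt_eqF.
rewrite /S [X in _ -> _ -> _ <= _ * (_ + X)]big_ord_recr /=.
have cpos : 0 <= \sum_(k < N.+1) c k * Z k t ^+ 2.
  by apply: sumr_ge0 => k _; rewrite mulr_ge0 ?sqr_ge0.
have dpos : 0 <= \sum_(k < N) d k * L k t ^+ 2.
  by apply: sumr_ge0 => k _; rewrite mulr_ge0 ?sqr_ge0.
have := E_ge0 t; move: cpos dpos.
set e := E t; set sc := \sum_(k < N.+1) c k * Z k t ^+ 2.
set sd := \sum_(k < N) d k * L k t ^+ 2.
set s1 := \sum_(k < N.+1) c k * (2 * _); set s2 := \sum_(k < N.+1) d k * (2 * _).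
move=> sc0 sd0 e0 h2 h1.
have {}h2 : s2 <= 2 * eps * sd + L N t ^+ 2 by rewrite mulrA dN mul1r in h2.
have -> : 4 * eps * (e + sc + (sd + d N * L N t ^+ 2))
  = 4 * (eps * e) + 4 * (eps * sc) + 4 * (eps * sd) + 4 * (eps * d N) * L N t ^+ 2 by ring.
rewrite dN.
have e1 : 0 <= eps * e by rewrite mulr_ge0 // ltW.
have e2 : 0 <= eps * sc by rewrite mulr_ge0 // ltW.
have e3 : 0 <= eps * sd by rewrite mulr_ge0 // ltW.
have e4 : eps * (1 / 2 * Z N.+1 t ^+ 2) <= 1 / 2 * Z N.+1 t ^+ 2.
  by rewrite ler_piMl // mulr_ge0 ?sqr_ge0.
have e5 : 0 <= (Z N.+1 t + 2 * L N t) ^+ 2 by exact: sqr_ge0.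
have e6 : (Z N.+1 t + 2 * L N t) ^+ 2
  = Z N.+1 t ^+ 2 + 4 * (Z N.+1 t * L N t) + 4 * L N t ^+ 2 by ring.
have -> : 2 * Z N.+1 t * L N t = 2 * (Z N.+1 t * L N t) by ring.
have e7 : 0 <= L N t ^+ 2 by exact: sqr_ge0.
have e8 : 2 * eps * sd = 2 * (eps * sd) by ring.
have e9 : 2 * eps * sc = 2 * (eps * sc) by ring.
rewrite e8 in h2; rewrite e9 in h1; rewrite e6 in e5.
lra.
Qed.

Let K1 := \sum_(k < N.+1) `|beta k| + N.+1%:R * Qb.

Let M_ge0 : 0 <= M.
Proof.
apply: le_trans (M_ge (leq0n N) (u := 0) _); first exact: normr_ge0.
by rewrite lexx oppr_le0 ltW.
Qed.

Let Qb_ge0 : 0 <= Qb.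
Proof.
apply: le_trans (Qb_ge (leq0n N) (v := 0) _); first exact: normr_ge0.
by rewrite lexx oppr_le0 ltW.
Qed.

Let res_le u : - tau <= u <= 0 -> `|res 0 u| <= K1 * M.
Proof.
move=> tu; rewrite /res /K1 mulrDl (le_trans (ler_normB _ _)) // lerD //.
  rewrite (le_trans (ler_norm_sum _ _ _)) // mulr_suml ler_sum // => k _.
  by rewrite normrM ler_wpM2l // M_ge // -ltnS.
rewrite (le_trans (ler_norm_sum _ _ _)) // -mulrA mulr_natl.
rewrite -[N.+1 in leRHS]card_ord -sumr_const ler_sum // => k _.
rewrite normrM mulrC ler_pM // ?subr0.
  by rewrite Qb_ge // -ltnS.
by rewrite M_ge // -1?ltnS // lexx oppr_le0 ltW.
Qed.

Let S0_le : S 0 <= (K1 ^+ 2 * tau + \sum_(k < N.+1) c k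
  + \sum_(k < N.+1) d k * (K1 * Qb * tau) ^+ 2) * M ^+ 2.
Proof.
have Nt0 : - tau <= 0 :> R by rewrite oppr_le0 ltW.
rewrite /S [leRHS]mulrDl [X in _ <= X + _]mulrDl; apply: lerD; first apply: lerD.
- rewrite EE sub0r; apply: le_trans (ler_norm _) _.
  have -> : K1 ^+ 2 * tau * M ^+ 2 = (K1 * M) ^+ 2 * (0 - - tau) by ring.
  apply: integ_norm_le => //; first exact: continuous_mul.
  by move=> u tu; rewrite normrM expr2 ler_pM // res_le.
- rewrite mulr_suml ler_sum // => k _; rewrite ler_wpM2l //.
  rewrite -[leLHS]real_normK ?num_real // lerXn2r ?nnegrE //.
  by rewrite M_ge // -1?ltnS // lexx oppr_le0 ltW.
- rewrite mulr_suml ler_sum // => k _; rewrite -[leRHS]mulrA -exprMn.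
  apply: ler_wpM2l; first exact: d_ge0.
  rewrite -[leLHS]real_normK ?num_real //.
  have Lk : `|L k 0| <= K1 * Qb * tau * M.
    rewrite LE sub0r.
    have -> : K1 * Qb * tau * M = K1 * M * Qb * (0 - - tau) by ring.
    have cqk : continuous (fun u : R => q k (u - 0)).
      have -> : (fun u : R => q k (u - 0)) = q k by apply/funext => v; rewrite subr0.
      exact: cq.
    apply: integ_norm_le => //; first exact: continuous_mul.
    move=> u tu; rewrite normrM ler_pM // ?res_le // subr0 Qb_ge // -ltnS.
    exact: ltn_ord.
  have r0 := le_trans (normr_ge0 _) Lk.
  by apply: lerXn2r; rewrite ?nnegrE.
Qed.

(** Apply [gronwall] to $S$ and, all its terms being nonnegative, keep only $c_0Z_0^2$ on the
    left. *)
Lemma energy_growth t : 0 <= t ->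
  (eps ^+ 2) ^+ N.+1 / 2 * Z 0 t ^+ 2
  <= energy_const N tau Qb eps beta * M ^+ 2 * expR (4 * eps * t).
Proof.
move=> t0.
have St := @gronwall _ S _ (4 * eps) t t0 dS (fun t _ => dS_le t).
apply: le_trans (le_trans _ St) _; last by rewrite ler_wpM2r ?expR_ge0.
have hs : c 0 * Z 0 t ^+ 2 <= \sum_(k < N.+1) c k * Z k t ^+ 2.
  rewrite big_ord_recl lerDl; apply: sumr_ge0 => k _.
  by rewrite mulr_ge0 ?sqr_ge0.
have hd : 0 <= \sum_(k < N.+1) d k * L k t ^+ 2.
  by apply: sumr_ge0 => k _; rewrite mulr_ge0 ?sqr_ge0.
rewrite {1}/c subn0 in hs; apply: le_trans hs _.
by rewrite /S -addrA addrCA lerDl addr_ge0.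
Qed.

End Lyapunov.
End Energy.

Section KernelGrowth.
Context {R : realType} (N : nat) (tau : R) (beta b : nat -> R) (q : nat -> R -> R).
Hypothesis tau_gt0 : 0 < tau.
Hypothesis dq : forall j (v : R), is_derive v 1 (q j) (prev (q ^~ v) j).
Hypothesis q0 : forall j, q j 0 = beta j.
Hypothesis qtau : forall j, q j (- tau) = - b j.
Hypothesis beta_gt : forall j, (N < j)%N -> beta j = 0.
Hypothesis b_top : b N.+1 = 1.
Hypothesis b_gt : forall j, (N.+1 < j < 2 * N.+1)%N -> b j = 0.

Lemma kernel_bounded : exists Qb, forall j v,
  (j <= N)%N -> - tau <= v <= 0 -> `|q j v| <= Qb.
Proof.
have bnd j : exists B, forall v, - tau <= v <= 0 -> `|q j v| <= B.
  have cj : continuous (fun v => q j v * q j v).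
    by apply: continuous_mul; exact: (is_derive_continuous (dq j)).
  have [|c _ H] := @EVT_max R _ (- tau) 0 _ (continuous_subspaceT cj).
    by rewrite oppr_le0 ltW.
  (* From $|q_j|\le1+q_j^2$ and the maximum of $q_j^2$ at [c]. *)
  exists (1 + q j c * q j c) => v tv; have /H : v \in `[- tau, 0] by rewrite in_itv.
  rewrite -expr2 -[_ ^+ 2]real_normK ?num_real // => h.
  have := sqr_ge0 (`|q j v| - 1); rewrite sqrrB1 mulr2n.
  by have := normr_ge0 (q j v); move: h; lra.
have [B HB] := choice bnd.
exists (\sum_(j < N.+1) `|B j|) => j v jN tv.
rewrite (le_trans (HB j v tv)) // (le_trans (ler_norm _)) //.
rewrite (bigD1 (Ordinal (jN : (j < N.+1)%N))) //= lerDl.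
by apply: sumr_ge0.
Qed.

(** The constant is chosen before the solution, as exponential stability requires. *)
Lemma kernel_growth (eps : R) : 0 < eps -> eps <= 1 ->
  exists K, forall (Z : nat -> R -> R) M,
    (forall k (t : R), (k <= N)%N -> is_derive t 1 (Z k) (Z k.+1 t)) ->
    (forall t, 0 <= t -> Z N.+1 t + \sum_(k < N.+1) b k * Z k t
       + \sum_(k < N.+1) beta k * Z k (t - tau) = 0) ->
    (forall k u, (k <= N)%N -> - tau <= u <= 0 -> `|Z k u| <= M) ->
    forall t, 0 <= t -> Z 0 t ^+ 2 <= K * M ^+ 2 * expR (4 * eps * t).
Proof.
move=> e0 e1; have [Qb HQ] := kernel_bounded.
pose c0 := (eps ^+ 2) ^+ N.+1 / 2.
have c0_gt0 : 0 < c0 by rewrite divr_gt0 // exprn_gt0 // exprn_gt0.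
exists (energy_const N tau Qb eps beta / c0) => Z M dZ dde HM t t0.
have := energy_growth tau_gt0 dq q0 qtau beta_gt b_top b_gt dZ dde e0 e1 HQ HM t0.
rewrite -/c0 mulrC -ler_pdivlMr // => /le_trans; apply.
by rewrite le_eqVlt; apply/orP; left; apply/eqP; ring.
Qed.

End KernelGrowth.

(** * Coefficients *)

Lemma derivn_shift {R : comNzRingType} (p : {poly R}) c i :
  p^`(i).[c] = (p \Po ('X + c%:P))`_i *+ i`!.
Proof.
have -> : (p \Po ('X + c%:P))`_i *+ i`! = (p \Po ('X + c%:P))^`(i).[0].
  by rewrite horner_coef0 coef_derivn addn0 ffactnn.
have -> : (p \Po ('X + c%:P))^`(i) = p^`(i) \Po ('X + c%:P).
  elim: i => [|i IHi]; first by rewrite !derivn0.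
  by rewrite !derivnS IHi deriv_comp derivD derivX derivC addr0 mulr1.
by rewrite horner_comp !hornerE.
Qed.

Lemma coef_XaddC_exp {R : comNzRingType} (c : R) n i :
  (('X + c%:P) ^+ n)`_i = c ^+ (n - i) *+ 'C(n, i).
Proof.
have -> : ('X + c%:P) ^+ n = \poly_(i < n.+1) (c ^+ (n - i) *+ 'C(n, i)).
  rewrite addrC exprDn poly_def; apply: eq_bigr => k _.
  by rewrite -polyC_exp mul_polyC scalerMnl.
by rewrite coef_poly ltnS; case: leqP => // ni; rewrite bin_small.
Qed.

Lemma coef_poly_shift {R : comNzRingType} (u : nat -> R) m c j :
  (\poly_(k < m) u k \Po ('X + c%:P))`_j
  = \sum_(k < m) u k * (c ^+ (k - j) *+ 'C(k, j)).
Proof.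
rewrite poly_def linear_sum coef_sum; apply: eq_bigr => k _ /=.
by rewrite linearZ /= comp_Xn_poly coefZ coef_XaddC_exp.
Qed.

Lemma shift_polyK {R : comNzRingType} (c : R) (p : {poly R}) :
  (p \Po ('X + c%:P)) \Po ('X - c%:P) = p.
Proof.
rewrite -comp_polyA comp_polyD comp_polyX comp_polyC subrK.
by rewrite comp_polyXr.
Qed.

Lemma comp_shift_eq {R : comNzRingType} (c : R) (p q : {poly R}) :
  (p \Po ('X + c%:P) = q) <-> (p = q \Po ('X - c%:P)).
Proof.
split=> [<-|->]; first by rewrite shift_polyK.
by have := shift_polyK (- c) q; rewrite polyCN opprK.
Qed.

Lemma dvdp_exp_shift {F : fieldType} (p : {poly F}) c m :
  (forall i, (i < m)%N -> (p \Po ('X + c%:P))`_i = 0) -> ('X - c%:P) ^+ m %| p.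
Proof.
move=> p0; rewrite -(shift_polyK c p).
have -> : p \Po ('X + c%:P) = drop_poly m (p \Po ('X + c%:P)) * 'X^m.
  rewrite -[LHS](poly_take_drop m) (_ : take_poly m _ = 0) ?add0r //.
  by apply/polyP => i; rewrite coef_take_poly coef0; case: ltnP => // /p0.
by rewrite comp_polyM comp_Xn_poly dvdp_mull.
Qed.

(* kpoly beta j is Q(D) applied to X^j / j!, where Q = sum_k beta_k X^k. *)
Definition kpoly {R : realType} (beta : nat -> R) j : {poly R} :=
  \sum_(k < j.+1) (beta k / (j - k)`!%:R) *: 'X^(j - k).

Lemma deriv_kpoly {R : realType} (beta : nat -> R) j :
  (kpoly beta j)^`() = prev (kpoly beta) j.
Proof.
case: j => [|j] /=; rewrite /kpoly big_ord_recr /= subnn expr0 alg_polyC derivD derivC.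
  by rewrite big_ord0 deriv0 addr0.
rewrite addr0 raddf_sum; apply: eq_bigr => k _ /=; rewrite derivZ derivXn.
have kj : (k <= j)%N by rewrite -ltnS.
rewrite subSn //= -scalerMnr scalerMnl; congr (_ *: _).
by rewrite factS natrM invfM mulrA -mulr_natr mulrAC mulfVK ?pnatr_eq0.
Qed.

Lemma derivn_kpoly {R : realType} (beta : nat -> R) i j :
  (kpoly beta (i + j))^`(i) = kpoly beta j.
Proof.
elim: i j => [|i IHi] j; first by rewrite derivn0.
by rewrite derivnS addSnnS IHi deriv_kpoly.
Qed.

Lemma horner_kpoly0 {R : realType} (beta : nat -> R) j : (kpoly beta j).[0] = beta j.
Proof.
rewrite /kpoly horner_sum big_ord_recr /= subnn expr0 alg_polyC hornerC divr1.
rewrite big1 ?add0r // => k _; rewrite hornerZ hornerXn expr0n subn_eq0.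
by rewrite leqNgt ltn_ord mulr0.
Qed.

Lemma coef_kpoly {R : realType} (beta : nat -> R) j i : (i <= j)%N ->
  (kpoly beta j)`_i = beta (j - i)%N / i`!%:R.
Proof.
move=> ij; have := horner_kpoly0 beta (j - i).
rewrite -(derivn_kpoly beta i) subnKC // horner_coef0 coef_derivn addn0 ffactnn => <-.
by rewrite -(mulr_natr (kpoly beta j)`_i) mulfK // pnatr_eq0 -lt0n fact_gt0.
Qed.

Lemma size_kpoly {R : realType} (beta : nat -> R) j : (size (kpoly beta j) <= j.+1)%N.
Proof.
apply: (leq_trans (size_sum _ _ _)); apply/bigmax_leqP => k _.
by rewrite (leq_trans (size_scale_leq _ _)) // size_polyXn ltnS leq_subr.
Qed.

Section Coefficients.
Context {R : realType} (n : nat) (tau : R).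
Hypothesis n_gt0 : (0 < n)%N.
Hypothesis tau_gt0 : 0 < tau.

(** These are the formulas of (a) at $s_0=0$, for $P$ here and for $Q$ in [beta_explicit]. The
    binomial gives the value 1 at $j=n$ and 0 for $n<j<2n$; [beta_explicit] needs a case
    distinction, since the truncated $n-j-1$ would not make it vanish. *)
Definition b_explicit j : R :=
  (-1) ^+ (n - j) * n`!%:R * 'C(2 * n - j - 1, n - 1)%:R / (j`!%:R * tau ^+ (n - j)).

Definition beta_explicit j : R := if (n <= j)%N then 0 else
  (-1) ^+ (n - 1) * (2 * n - j - 1)`!%:R / (j`! * (n - j - 1)`!)%:R / tau ^+ (n - j).

(* The j-th Taylor coefficient at 0 of sum_k b_k s^k + e^(-s tau) sum_k beta_k s^k
   is b j + (kpoly beta j).[- tau]. *)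
Definition taylor_zero (b beta : nat -> R) :=
  forall j, (j < 2 * n)%N -> b j + (kpoly beta j).[- tau] = 0.

Let tau_neq0 : tau != 0. Proof. exact: lt0r_neq0. Qed.

(* kpoly beta (2n - 1) has degree at most 2n - 1 and, when the Taylor
   coefficients of order n, ..., 2n - 1 vanish, zeros of order n at 0 and n - 1
   at - tau, which determines it. *)
Let U : {poly R} :=
  ((-1) ^+ (n - 1) / ((n - 1)`!%:R * tau ^+ n)) *: ('X^n * ('X + tau%:P) ^+ (n - 1)).

Let fact_neq0 m : m`!%:R != 0 :> R.
Proof. by rewrite pnatr_eq0 -lt0n fact_gt0. Qed.

Let kpoly_explicit : kpoly beta_explicit (2 * n - 1) = U.
Proof.
apply/polyP => i; rewrite coefZ coefXnM.
have [i2|i2] := leqP (2 * n) i.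
  rewrite nth_default; last by rewrite (leq_trans (size_kpoly _ _)) //; lia.
  rewrite ltnNge (_ : (n <= i)%N) /=; last by lia.
  by rewrite coef_XaddC_exp bin_small ?mulr0 //; lia.
rewrite coef_kpoly; last by lia.
rewrite /beta_explicit; case: ltnP => ni.
  by rewrite (_ : (n <= 2 * n - 1 - i)%N) ?mul0r ?mulr0 //; lia.
rewrite leqNgt (_ : (2 * n - 1 - i < n)%N) /=; last by lia.
(* Writing $i=n+m$ and $n=m+p+1$ removes all truncated subtractions. *)
have [m im] : exists m, i = (n + m)%N by exists (i - n)%N; lia.
have [p np] : exists p, n = (m + p).+1 by exists (n - m).-1; lia.
rewrite coef_XaddC_exp im np.
rewrite (_ : 2 * (m + p).+1 - (2 * (m + p).+1 - 1 - ((m + p).+1 + m)) - 1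
  = (m + p).+1 + m)%N; last by lia.
rewrite (_ : 2 * (m + p).+1 - 1 - ((m + p).+1 + m) = p)%N; last by lia.
rewrite (_ : (m + p).+1 - p - 1 = m)%N; last by lia.
rewrite (_ : (m + p).+1 - p = m.+1)%N; last by lia.
rewrite (_ : (m + p).+1 - 1 = m + p)%N; last by lia.
rewrite (_ : (m + p).+1 + m - (m + p).+1 = m)%N; last by lia.
rewrite (_ : m + p - m = p)%N; last by lia.
have := fact_neq0 ((m + p).+1 + m); move: ((m + p).+1 + m)`! => x x0.
have := bin_fact (leq_addr p m); rewrite addKn => /(congr1 (fun k => k%:R : R)) E.
rewrite -E !natrM -mulr_natr.
have -> : tau ^+ (m + p).+1 = tau ^+ m.+1 * tau ^+ p by rewrite -exprD addSn.
have := fact_neq0 p; have := fact_neq0 m.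
have c0 : 'C(m + p, m)%:R != 0 :> R by rewrite pnatr_eq0 -lt0n bin_gt0 leq_addr.
have := expf_neq0 p tau_neq0; have := expf_neq0 m.+1 tau_neq0.
by move=> h1 h2 h3 h4; field; rewrite h1 h2 h3 h4 c0 x0.
Qed.

(** The polynomial at index $j$ is the derivative of $U$ of order $2n-1-j$, so its value at $-\tau$
    is read off the expansion of $U$ there, a multiple of $(X-\tau)^nX^{n-1}$ after translation. *)
Lemma taylor_zero_explicit : taylor_zero b_explicit beta_explicit.
Proof.
move=> j j2.
have -> : kpoly beta_explicit j = U^`(2 * n - 1 - j).
  have jE : (2 * n - 1 = 2 * n - 1 - j + j)%N by lia.
  by rewrite -kpoly_explicit [in kpoly _ (_ - 1)]jE derivn_kpoly.
rewrite derivn_shift /U linearZ /= comp_polyM comp_Xn_poly.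
rewrite (rmorphXn (comp_poly _)) /= comp_polyD comp_polyX comp_polyC.
rewrite polyCN addrNK coefZ coefMXn -polyCN coef_XaddC_exp /b_explicit.
have [nj|jn] := ltnP n j.
  rewrite (_ : (2 * n - 1 - j < n - 1)%N) ?mulr0 ?mul0rn ?addr0; last by lia.
  by rewrite bin_small ?mulr0 ?mul0r //; lia.
rewrite ltnNge (_ : (n - 1 <= 2 * n - 1 - j)%N) /=; last by lia.
have [m nm] : exists m, n = (j + m)%N by exists (n - j)%N; lia.
have [p np] : exists p, n = p.+1 by exists n.-1; lia.
rewrite (_ : 2 * n - 1 - j - (n - 1) = m)%N; last by lia.
rewrite (_ : 2 * n - j - 1 = p + m)%N; last by lia.
rewrite (_ : 2 * n - 1 - j = p + m)%N; last by lia.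
rewrite (_ : n - j = m)%N; last by lia.
rewrite (_ : n - m = j)%N; last by lia.
rewrite (_ : n - 1 = p)%N; last by lia.
have e1 := bin_fact (leq_addr m p); rewrite addKn in e1.
have e2 := bin_fact (leq_addl j m); rewrite addnK -nm in e2.
(* Since $p+1=n=j+m$; this minus sign makes the two terms cancel. *)
have -> : (-1) ^+ p = - ((-1) ^+ j * (-1) ^+ m) :> R.
  by rewrite -exprD -nm np exprS mulN1r opprK.
have -> : (- tau) ^+ j = (-1) ^+ j * tau ^+ j by rewrite -exprMn mulN1r.
have -> : tau ^+ n = tau ^+ j * tau ^+ m by rewrite -exprD nm.
move: (p + m)`! n`! e1 e2 => f g <- <-.
have := fact_neq0 m; have := fact_neq0 j; have := fact_neq0 p.
have := expf_neq0 j tau_neq0; have := expf_neq0 m tau_neq0.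
move: (m`!) (j`!) (p`!) ('C(n, m)) ('C(p + m, p)) => x y z u v h1 h2 h3 h4 h5.
rewrite -[_ *+ (v * _)]mulr_natr -[_ *+ u]mulr_natr !natrM.
have sj : (-1) ^+ j * (-1) ^+ j = 1 :> R by rewrite -expr2 sqrr_sign.
transitivity ((-1) ^+ m * (1 - (-1) ^+ j * (-1) ^+ j) * (u%:R * x%:R * v%:R / tau ^+ m) : R).
  by field; rewrite ?h1 ?h2 ?h3 ?h4 ?h5.
by rewrite sj subrr mulr0 mul0r.
Qed.

Lemma b_explicit_top : b_explicit n = 1.
Proof.
rewrite /b_explicit subnn expr0 mul1r mulr1 (_ : 2 * n - n - 1 = n - 1)%N; last by lia.
by rewrite binn mulr1 divff.
Qed.

Lemma b_explicit_gt j : (n < j < 2 * n)%N -> b_explicit j = 0.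
Proof. by move=> nj; rewrite /b_explicit bin_small ?mulr0 ?mul0r //; lia. Qed.

(** The difference $D$ of the two kernels of index $2n-1$ has a zero of order $n$ at 0, because both
    [beta] vanish from $n$ on, and one at $-\tau$, because both [b] agree from $n$ to $2n-1$. Its
    degree is below $2n$, so $D=0$. Its derivatives at 0 give the equality of the [beta], and then
    the Taylor conditions give that of the [b]. *)
Lemma taylor_zero_unique b beta :
  (forall j, (n <= j)%N -> beta j = 0) -> b n = 1 ->
  (forall j, (n < j < 2 * n)%N -> b j = 0) -> taylor_zero b beta ->
  forall j, (j < n)%N -> b j = b_explicit j /\ beta j = beta_explicit j.
Proof.
move=> beta_ge bn b_gt Tb.
pose delta j := beta j - beta_explicit j.
have kB j : kpoly delta j = kpoly beta j - kpoly beta_explicit j.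
  by rewrite /kpoly -sumrB; apply: eq_bigr => k _; rewrite -scalerBl -mulrBl.
pose D := kpoly delta (2 * n - 1).
have D0 : D = 0.
  have XnD : ('X - 0%:P) ^+ n %| D.
    apply: dvdp_exp_shift => i ni; rewrite addr0 comp_polyXr coef_kpoly; last by lia.
    rewrite /delta beta_ge ?/beta_explicit; last by lia.
    by rewrite (_ : (n <= 2 * n - 1 - i)%N) ?subrr ?mul0r //; lia.
  have XtD : ('X - (- tau)%:P) ^+ n %| D.
    apply: dvdp_exp_shift => i ni.
    have j2 : (2 * n - 1 - i < 2 * n)%N by lia.
    have : D^`(i).[- tau] = 0.
      rewrite /D (_ : 2 * n - 1 = i + (2 * n - 1 - i))%N ?derivn_kpoly; last by lia.
      rewrite kB hornerD hornerN.
      have := Tb _ j2; have := taylor_zero_explicit j2.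
      have -> : b (2 * n - 1 - i)%N = b_explicit (2 * n - 1 - i); last by lra.
      have [->|jn] := eqVneq (2 * n - 1 - i)%N n; first by rewrite bn b_explicit_top.
      by rewrite b_gt ?b_explicit_gt //; lia.
    rewrite derivn_shift => /eqP; rewrite mulrn_eq0 => /orP[|/eqP //].
    by rewrite gtn_eqF // fact_gt0.
  have cop : coprimep (('X - 0%:P) ^+ n) (('X - (- tau)%:P) ^+ n).
    apply: coprimep_expl; apply: coprimep_expr.
    by rewrite coprimep_XsubC2 // subr0 oppr_eq0.
  have /dvdp_leq : (('X - 0%:P) ^+ n * ('X - (- tau)%:P) ^+ n) %| D.
    by rewrite Gauss_dvdp // XnD XtD.
  case: (eqVneq D 0) => // nzD /(_ isT).
  have mon (c : R) : ('X - c%:P) ^+ n \is monic by rewrite monic_exp // monicXsubC.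
  rewrite size_Mmonic ?monic_neq0 // !size_exp_XsubC.
  have := size_kpoly delta (2 * n - 1); rewrite -/D => h1 h2.
  by have := leq_trans h2 h1; lia.
have betaE j : (j < 2 * n)%N -> beta j = beta_explicit j.
  move=> j2; apply/eqP; rewrite -subr_eq0 -/(delta j) -horner_kpoly0.
  rewrite -(derivn_kpoly delta (2 * n - 1 - j)) (_ : 2 * n - 1 - j + j = 2 * n - 1)%N; last by lia.
  by rewrite -/D D0 linear0 horner0.
move=> j jn; split; last by apply: betaE; lia.
have j2 : (j < 2 * n)%N by lia.
have := Tb j j2; have := taylor_zero_explicit j2.
rewrite (_ : kpoly beta j = kpoly beta_explicit j); last first.
  by apply: eq_bigr => k _; rewrite betaE //; have := ltn_ord k; lia.
by move=> <- /addIr.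
Qed.
End Coefficients.

(** * Translation of the root to the origin *)

Section Shift.
Context {R : realType} (n : nat) (tau s0 : R) (a alpha : nat -> R).
Hypothesis n_gt0 : (0 < n)%N.
Hypothesis tau_gt0 : 0 < tau.

Definition monic_poly : {poly R} := 'X^n + \poly_(k < n) a k.
Definition delay_poly : {poly R} := \poly_(k < n) alpha k.

(* Delta (s0 + s) =
   sum_k (shift_b k) s^k + e^(-s tau) sum_k (shift_beta k) s^k. *)
Definition shift_b j : R := (monic_poly \Po ('X + s0%:P))`_j.
Definition shift_beta j : R := expR (- (s0 * tau)) * (delay_poly \Po ('X + s0%:P))`_j.

Let monic_polyE : monic_poly = \poly_(k < n.+1) (if k == n then 1 else a k).
Proof.
apply/polyP => i; rewrite coefD coefXn !coef_poly ltnS.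
by case: ltngtP => // _; rewrite ?addr0 ?add0r.
Qed.

Lemma shift_b_top : shift_b n = 1.
Proof.
rewrite /shift_b monic_polyE coef_poly_shift big_ord_recr /= eqxx subnn binn mulr1n expr0 mulr1.
by rewrite big1 ?add0r // => k _; rewrite bin_small // mulr0n mulr0.
Qed.

Lemma shift_b_gt j : (n < j)%N -> shift_b j = 0.
Proof.
move=> nj; rewrite /shift_b monic_polyE coef_poly_shift big1 // => k _.
by rewrite bin_small ?mulr0n ?mulr0 //; apply: leq_trans (ltn_ord k) nj.
Qed.

Lemma shift_beta_ge j : (n <= j)%N -> shift_beta j = 0.
Proof.
move=> nj; rewrite /shift_beta coef_poly_shift big1 ?mulr0 // => k _.
by rewrite bin_small ?mulr0n ?mulr0 // (leq_trans (ltn_ord k)).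
Qed.

Let fact_neq0 m : m`!%:R != 0 :> R.
Proof. by rewrite pnatr_eq0 -lt0n fact_gt0. Qed.

(** The leading coefficient 1 produces the isolated binomial term of [a_formula], and the lower
    coefficients produce its sum. *)
Let a_shift k : (k <= n)%N ->
  ((\poly_(j < n.+1) b_explicit n tau j) \Po ('X + (- s0)%:P))`_k
  = if k == n then 1 else a_formula n tau s0 k.
Proof.
move=> kn; rewrite coef_poly_shift big_ord_recr /= b_explicit_top // mul1r.
have [->|kneq] := eqVneq k n.
  rewrite subnn expr0 binn big1 ?add0r // => j _.
  by rewrite bin_small // mulr0n mulr0.
rewrite /a_formula addrC -mulr_natl; congr (_ + _).
rewrite mulr_sumr big_geq_mkord [RHS]big_mkcond /=.
apply: eq_bigr => j _; case: leqP => kj; last by rewrite bin_small // mulr0n mulr0.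
rewrite /b_explicit natrM (exprNn s0) -[_ *+ 'C(j, k)]mulr_natr.
have jn := ltn_ord j.
have -> : (-1) ^+ (n - k) = (-1) ^+ (n - j) * (-1) ^+ (j - k) :> R.
  by rewrite -exprD; congr (_ ^+ _); lia.
have := fact_neq0 j; have := expf_neq0 (n - j) (lt0r_neq0 tau_gt0).
by move=> h1 h2; field; rewrite h1 h2.
Qed.

Let alpha_shift k : (k < n)%N ->
  expR (s0 * tau) * ((\poly_(j < n) beta_explicit n tau j) \Po ('X + (- s0)%:P))`_k
  = alpha_formula n tau s0 k.
Proof.
move=> kn; rewrite coef_poly_shift /alpha_formula !mulr_sumr.
rewrite big_geq_mkord [RHS]big_mkcond /=.
apply: eq_bigr => j _; case: leqP => kj; last by rewrite bin_small // mulr0n !mulr0.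
rewrite /beta_explicit leqNgt ltn_ord /= (exprNn s0) -[_ *+ 'C(j, k)]mulr_natr.
have e := bin_fact kj.
have -> : (j`! * (n - j - 1)`!)%:R
    = 'C(j, k)%:R * (k`!%:R * (j - k)`!%:R) * (n - j - 1)`!%:R :> R.
  by rewrite -!natrM e.
have -> : (k`! * (j - k)`! * (n - j - 1)`!)%:R
    = k`!%:R * (j - k)`!%:R * (n - j - 1)`!%:R :> R.
  by rewrite -!natrM.
have c0 : 'C(j, k)%:R != 0 :> R by rewrite pnatr_eq0 -lt0n bin_gt0.
have := fact_neq0 (j - k); have := fact_neq0 k; have := fact_neq0 (n - j - 1).
have := expf_neq0 (n - j) (lt0r_neq0 tau_gt0).
move: (k`!) ((j - k)`!) ((n - j - 1)`!) ((2 * n - j - 1)`!) c0 => x y z u c0 h1 h2 h3 h4.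
by field; rewrite ?h1 ?h2 ?h3 ?h4 ?c0.
Qed.

(** Translation by $s_0$ is invertible on polynomials, so the formulas of (a) are equivalent to
    their translates. *)
Lemma coeff_conditionsP : coeff_conditions n tau s0 a alpha <->
  forall j, (j < n)%N ->
    shift_b j = b_explicit n tau j /\ shift_beta j = beta_explicit n tau j.
Proof.
have aP : (forall k, (k < n)%N -> a k = a_formula n tau s0 k) <->
    (forall j, (j < n)%N -> shift_b j = b_explicit n tau j).
  have [e1 e2] := comp_shift_eq s0 monic_poly (\poly_(j < n.+1) b_explicit n tau j).
  rewrite -polyCN in e1 e2.
  split=> H.
    have /e2 E : monic_poly = (\poly_(j < n.+1) b_explicit n tau j) \Po ('X + (- s0)%:P).
      apply/polyP => k; have [nk|kn] := ltnP n k.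
        rewrite monic_polyE coef_poly ltnS leqNgt nk /= coef_poly_shift big1 // => j _.
        by rewrite bin_small ?mulr0n ?mulr0 //; apply: leq_trans (ltn_ord j) nk.
      rewrite a_shift // monic_polyE coef_poly ltnS kn.
      by case: eqVneq => // kneq; rewrite H // ltn_neqAle kneq.
    by move=> j jn; rewrite /shift_b E coef_poly ltnS ltnW.
  have /e1 E : monic_poly \Po ('X + s0%:P) = \poly_(j < n.+1) b_explicit n tau j.
    apply/polyP => k; rewrite -/(shift_b k) coef_poly ltnS.
    case: ltngtP => [kn|nk|->]; [exact: H|exact: shift_b_gt|].
    by rewrite shift_b_top b_explicit_top.
  move=> k kn; have := a_shift (ltnW kn); rewrite -E monic_polyE coef_poly ltnS ltnW //.
  by rewrite ltn_eqF.
have alphaP : (forall k, (k < n)%N -> alpha k = alpha_formula n tau s0 k) <->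
    (forall j, (j < n)%N -> shift_beta j = beta_explicit n tau j).
  have e0 : expR (s0 * tau) * expR (- (s0 * tau)) = 1 by rewrite expRxMexpNx_1.
  have [e1 e2] := comp_shift_eq s0 delay_poly
    (expR (s0 * tau) *: \poly_(j < n) beta_explicit n tau j).
  rewrite -polyCN in e1 e2.
  split=> H.
    have /e2 E : delay_poly = (expR (s0 * tau) *: \poly_(j < n) beta_explicit n tau j)
        \Po ('X + (- s0)%:P).
      apply/polyP => k; rewrite comp_polyZ coefZ coef_poly.
      have [kn|nk] := ltnP k n; first by rewrite alpha_shift // H.
      rewrite coef_poly_shift big1 ?mulr0 // => j _.
      by rewrite bin_small ?mulr0n ?mulr0 //; apply: leq_trans (ltn_ord j) nk.
    by move=> j jn; rewrite /shift_beta E coefZ coef_poly jn mulrA (mulrC (expR (- _))) e0 mul1r.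
  have /e1 E : delay_poly \Po ('X + s0%:P) = expR (s0 * tau) *: \poly_(j < n) beta_explicit n tau j.
    apply/polyP => k; rewrite coefZ coef_poly.
    case: ltnP => kn; first by rewrite -H // /shift_beta mulrA e0 mul1r.
    have := shift_beta_ge kn; rewrite /shift_beta mulr0 => /eqP.
    by rewrite mulf_eq0 gt_eqF ?expR_gt0 //= => /eqP.
  move=> k kn; have := alpha_shift kn; rewrite -coefZ -comp_polyZ -E coef_poly kn.
  by [].
split=> [H j jn|H].
  by split; [apply: (aP.1 _ j jn)|apply: (alphaP.1 _ j jn)] => k kn; have [] := H k kn.
by move=> k kn; split; [apply: (aP.2 _ k kn)|apply: (alphaP.2 _ k kn)] => j jn; have [] := H j jn.
Qed.

End Shift.

(** * Complex derivatives *)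

Lemma is_derive_horner {K : numFieldType} (p : {poly K}) (x : K) :
  is_derive x (1 : K) (horner p) p^`().[x].
Proof.
elim/poly_ind: p => [|p c IHp].
  rewrite deriv0 horner0 (_ : horner 0 = cst 0); first exact: is_derive_cst.
  by apply/funext => y; rewrite horner0.
rewrite (_ : horner (p * 'X + c%:P) = horner p * id + cst c); last first.
  by apply/funext => y; rewrite !fctE !hornerE.
by apply: is_derive_eq; rewrite derivD derivM derivX derivC !hornerE /GRing.scale /=; ring.
Qed.

Section ComplexExponential.
Context {R : realType}.
Implicit Types z w : Cx R.

Lemma cexpD z w : cexp (z + w) = cexp z * cexp w.
Proof.
case: z w => [a b] [c d]; rewrite /cexp /= expRD cosD sinD.
by apply/eqP; rewrite eq_complex /=; apply/andP; split; apply/eqP; ring.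
Qed.

Lemma cexp_real (x : R) : cexp (RtoC x) = RtoC (expR x).
Proof. by rewrite /cexp /= cos0 sin0 mulr0 mulr1. Qed.

Lemma Cx_norm_le z : `|z| <= (`|complex.Re z| + `|complex.Im z|)%:C%C.
Proof.
case: z => a b; rewrite normc_def lecR /=.
rewrite -[leRHS]ger0_norm ?addr_ge0 // -sqrtr_sqr ler_wsqrtr //.
rewrite sqrrD !real_normK ?num_real //.
by rewrite -addrA lerD2l lerDr mulrn_wge0 // mulr_ge0.
Qed.

Lemma Cx_Re_le z : (`|complex.Re z|)%:C%C <= `|z|.
Proof. exact: normc_ge_Re. Qed.

Lemma Cx_Im_le z : (`|complex.Im z|)%:C%C <= `|z|.
Proof.
case: z => a b; rewrite normc_def lecR /= -sqrtr_sqr ler_wsqrtr //.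
by rewrite lerDr sqr_ge0.
Qed.

Lemma near0_derive_le (f : R -> R) (d e : R) : is_derive (0 : R) 1 f d -> 0 < e ->
  exists2 r, 0 < r & forall x, `|x| < r -> `|f x - f 0 - d * x| <= e * `|x|.
Proof.
move=> df e0.
have [fd fE] := df.
have /cvgrPdist_le /(_ e e0) : (h^-1 *: (f (h *: 1 + 0) - f 0) @[h --> 0^'] --> d)%classic.
  by rewrite -fE; exact: fd.
move=> /nbhs_ballP [r r0 H]; exists r => // x xr.
have [->|x0] := eqVneq x 0; first by rewrite subrr mulr0 subr0 !normr0 mulr0.
have := H x; rewrite /ball /= sub0r normrN => /(_ xr x0).
rewrite /GRing.scale /= mulr1 addr0 => h.
have -> : f x - f 0 - d * x = - ((d - x^-1 * (f x - f 0)) * x) by field.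
by rewrite normrN normrM ler_wpM2r.
Qed.

(** Complex differentiability of the exponential at 0, from the real derivatives of exp, cos and sin
    at 0. *)
Lemma cexp_near0 (e : R) : 0 < e ->
  exists2 r : R, 0 < r & forall z, `|z| < r%:C%C -> `|cexp z - 1 - z| <= e%:C%C * `|z|.
Proof.
move=> e0.
(* The errors of the two components add up to $d|x|+5d|y|$, and $10d\le e$ makes this at most
   $e(|x|+|y|)/2\le e|z|$. The radius $d/2$ below ensures $|e^x-1|\le d$. *)
pose d := Num.min 1 (e / 10).
have d0 : 0 < d by rewrite lt_min ltr01 divr_gt0.
have d1 : d <= 1 by rewrite ge_min lexx.
have d6 : 10 * d <= e.
  have : d <= e / 10 by rewrite ge_min lexx orbT.
  lra.
have [r1 r10 H1] := near0_derive_le (is_derive_expR 0) d0.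
have [r2 r20 H2] := near0_derive_le (is_derive_cos 0) d0.
have [r3 r30 H3] := near0_derive_le (is_derive_sin 0) d0.
exists (Num.min (Num.min r1 r2) (Num.min r3 (d / 2))).
  by rewrite !lt_min r10 r20 r30 divr_gt0.
move=> z zr.
have zx := le_lt_trans (Cx_Re_le z) zr; have zy := le_lt_trans (Cx_Im_le z) zr.
case: z zx zy zr => x y /=; rewrite !ltcR !lt_min.
move=> /andP[/andP[x1 x2] /andP[x3 x4]] /andP[/andP[y1 y2] /andP[y3 y4]] _.
have := H1 x x1; have := H2 y y2; have := H3 y y3.
rewrite expR0 cos0 sin0 subr0 oppr0 mul0r subr0 !mul1r => hs hc he.
have ex : `|expR x - 1| <= d.
  rewrite (_ : expR x - 1 = (expR x - 1 - x) + x); last by ring.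
  rewrite (le_trans (ler_normD _ _)) //.
  have : d * `|x| <= `|x| by rewrite ler_piMl.
  by move: he x4; lra.
have e2 : expR x <= 2.
  by move: ex; rewrite ler_norml => /andP[_]; move: d1; lra.
apply: le_trans (Cx_norm_le _) _.
apply: le_trans (_ : (e * (`|x| / 2 + `|y| / 2))%:C%C <= _).
  rewrite lecR /= subr0.
  have hx : `|expR x * cos y - 1 - x| <= 2 * (d * `|y|) + d * `|x|.
    rewrite (_ : _ - 1 - x = expR x * (cos y - 1) + (expR x - 1 - x)); last by ring.
    rewrite (le_trans (ler_normD _ _)) // lerD // normrM ger0_norm ?expR_ge0 //.
    by rewrite ler_pM ?expR_ge0.
  have hy : `|expR x * sin y - y| <= 2 * (d * `|y|) + d * `|y|.
    rewrite (_ : _ - y = expR x * (sin y - y) + (expR x - 1) * y); last by ring.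
    rewrite (le_trans (ler_normD _ _)) // lerD // normrM.
      by rewrite ger0_norm ?expR_ge0 // ler_pM ?expR_ge0.
    by rewrite ler_wpM2r.
  have hd u : 0 <= u -> 10 * (d * u) <= e * u.
    by move=> u0; rewrite mulrA ler_wpM2r.
  have := hd _ (normr_ge0 x); have := hd _ (normr_ge0 y).
  have := mulr_ge0 (ltW e0) (normr_ge0 x); have := mulr_ge0 (ltW e0) (normr_ge0 y).
  by move: hx hy; rewrite mulrDr !(mulrA e); lra.
rewrite rmorphM /= ler_wpM2l ?ler0c ?(ltW e0) //.
have hh : (`|x|)%:C%C + (`|y|)%:C%C <= `|x +i* y|%C *+ 2.
  by rewrite mulr2n lerD // (Cx_Re_le (Complex x y), Cx_Im_le (Complex x y)).
rewrite -mulrDl rmorphM rmorphD /= fmorphV /= rmorph_nat.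
by rewrite ler_pdivrMr // mulr_natr.
Qed.

(** The addition formula reduces the difference quotient at $z$ to the estimate at 0. *)
Lemma is_derive_cexp_scale (c z : Cx R) :
  is_derive z (1 : Cx R) (fun s => cexp (- (s * c))) (- c * cexp (- (z * c))).
Proof.
have cv : (h^-1 *: (cexp (- ((h *: 1 + z) * c)) - cexp (- (z * c))) @[h --> 0^']
    --> - c * cexp (- (z * c)))%classic.
  apply/cvgrPdist_le => e e0; set E := cexp (- (z * c)).
  (* Positivity in the order of the complex numbers forces [e] to be real. *)
  have [eI eR] : complex.Im e = 0 /\ 0 < complex.Re e.
    by move: e0; rewrite ltcE /= => /andP[/eqP -> ->].
  pose k := complex.Re (`|E| * `|c|).
  have kE : `|E| * `|c| = k%:C%C by rewrite /k !normc_def -rmorphM.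
  have k0 : 0 <= k by rewrite -ler0c -kE mulr_ge0.
  (* Adding 1, here and in [c1], keeps the denominators positive when $c=0$. *)
  have d0 : 0 < complex.Re e / (k + 1) by rewrite divr_gt0 // ltr_wpDl.
  have [r r0 H] := cexp_near0 d0.
  pose c1 := complex.Re `|c| + 1.
  have cE : `|c| = (complex.Re `|c|)%:C%C by rewrite normc_def.
  have c0 : 0 <= complex.Re `|c| by rewrite -ler0c -cE.
  have c10 : 0 < c1 by rewrite ltr_wpDl.
  apply/nbhs_ballP; exists (r / c1)%:C%C => /=; first by rewrite ltcR divr_gt0.
  move=> h; rewrite /ball /= sub0r normrN => hr h0.
  have hc : `|- (h * c)| < r%:C%C.
    rewrite normrN normrM cE.
    have hE : `|h| = (complex.Re `|h|)%:C%C by rewrite normc_def.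
    move: hr; rewrite hE -rmorphM !ltcR ltr_pdivlMr // => hr.
    apply: le_lt_trans hr; rewrite ler_wpM2l ?lerDl //.
    by rewrite -ler0c -hE.
  have := H _ hc; set w := - (h * c) => Hw.
  have -> : cexp (- ((h *: 1 + z) * c)) = cexp w * E.
    by rewrite /E -cexpD; congr cexp; rewrite /w /GRing.scale /=; ring.
  have -> : - c * E - h^-1 *: (cexp w * E - E) = - (h^-1 * E * (cexp w - 1 - w)).
    by rewrite /w /GRing.scale /=; field.
  rewrite normrN !normrM normfV.
  apply: le_trans (_ : `|h|^-1 * `|E| * ((complex.Re e / (k + 1))%:C%C * `|w|) <= _).
    by rewrite ler_wpM2l // mulr_ge0 // invr_ge0.
  have hn : `|h| != 0 by rewrite normr_eq0.
  rewrite /w normrN normrM.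
  have -> : `|h|^-1 * `|E| * ((complex.Re e / (k + 1))%:C%C * (`|h| * `|c|))
    = (complex.Re e / (k + 1))%:C%C * (`|E| * `|c|).
    have cancel (u v p q : Cx R) : u != 0 -> u^-1 * v * (p * (u * q)) = p * (v * q).
      by move=> u0; field.
    exact: cancel.
  rewrite kE -rmorphM lecE /= eI eqxx /=.
  by rewrite mulrAC ler_pdivrMr ?ltr_wpDl // ler_wpM2l ?(ltW eR) // lerDl.
apply: DeriveDef; first by apply/cvg_ex; exists (- c * cexp (- (z * c))).
by apply: cvg_lim cv => //; exact: norm_hausdorff.
Qed.

End ComplexExponential.

(** * Derivatives of the quasipolynomial at a real point *)

Section Quasipolynomial.
Context {R : realType} (n : nat) (tau s0 : R) (a alpha : nat -> R).

(* The derivative of e^(-s tau) q(s) is e^(-s tau) (twist q)(s). *)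
Definition twist (q : {poly R}) : {poly R} := q^`() - tau *: q.

Lemma iter_twist_shift k (q : {poly R}) :
  iter k twist q \Po ('X + s0%:P) = iter k twist (q \Po ('X + s0%:P)).
Proof.
elim: k => //= k IHk; rewrite -IHk /twist linearB linearZ /=.
by rewrite deriv_comp derivD derivX derivC addr0 mulr1.
Qed.

(** Leibniz' rule for $e^{-s\tau}q(s)$ at 0. In the induction the factor $k+1$ splits as
    $i+(k+1-i)$: the first part comes from $q'$, the second from $-\tau q$. *)
Lemma iter_twist0 k (q : {poly R}) :
  (iter k twist q).[0] = k`!%:R * \sum_(i < k.+1) q`_i * ((- tau) ^+ (k - i) / (k - i)`!%:R).
Proof.
elim: k q => [|k IHk] q.
  by rewrite big_ord1 /= subnn expr0 fact0 divr1 mulr1 mul1r horner_coef0.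
have fact_neq0 m : m`!%:R != 0 :> R by rewrite pnatr_eq0 -lt0n fact_gt0.
rewrite iterSr IHk; pose h i := q`_i * ((- tau) ^+ (k.+1 - i) / (k.+1 - i)`!%:R).
pose f i := i%:R * h i; pose g i := (k.+1 - i)%:R * h i.
have -> : \sum_(i < k.+1) (twist q)`_i * ((- tau) ^+ (k - i) / (k - i)`!%:R)
    = \sum_(i < k.+1) f i.+1 + \sum_(i < k.+1) g i.
  rewrite -big_split; apply: eq_bigr => i _ /=.
  have ik : (i <= k)%N by rewrite -ltnS.
  rewrite /f /g /h coefB coefZ coef_deriv subSS subSn // exprS factS natrM.
  have := fact_neq0 (k - i)%N; move: ((k - i)`!) => x x0.
  have k0 : (k - i).+1%:R != 0 :> R by rewrite pnatr_eq0.
  move: ((k - i).+1%:R : R) k0 => y y0.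
  by rewrite -mulr_natr; field; rewrite x0; exact: y0.
have -> : \sum_(i < k.+1) f i.+1 = \sum_(i < k.+2) f i.
  by rewrite [RHS]big_ord_recl /= [X in _ = X + _]mul0r add0r.
have -> : \sum_(i < k.+1) g i = \sum_(i < k.+2) g i.
  by rewrite [RHS]big_ord_recr /= [X in _ = _ + X](_ : _ = 0) ?addr0 // /g subnn mul0r.
rewrite -big_split factS natrM -[RHS]mulrA [RHS]mulrCA; congr (_ * _).
rewrite mulr_sumr; apply: eq_bigr => i _ /=.
have ik : (i <= k.+1)%N by rewrite -ltnS.
by rewrite /f /g -mulrDl -natrD subnKC.
Qed.

Let Cpoly (p : {poly R}) : {poly Cx R} := map_poly (real_complex R) p.

(** This family is closed under differentiation, so all derivatives are computed on pairs of real
    polynomials. *)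
Let quasi (p q : {poly R}) (s : Cx R) : Cx R :=
  (Cpoly p).[s] + cexp (- (s * RtoC tau)) * (Cpoly q).[s].

Let derive1_quasi p q : derive1 (quasi p q) = quasi p^`() (twist q).
Proof.
apply/funext => s; rewrite derive1E.
have dp := is_derive_horner (Cpoly p) s.
have dq := is_derive_horner (Cpoly q) s.
have de := is_derive_cexp_scale (RtoC tau) s.
have d : is_derive s (1 : Cx R) (quasi p q) (quasi p^`() (twist q) s).
  rewrite /quasi; apply: is_derive_eq.
  rewrite /twist /Cpoly !deriv_map rmorphB /= map_polyZ hornerD hornerN hornerZ.
  by rewrite /GRing.scale /= -[(tau%:C)%C]/(RtoC tau); ring.
by rewrite derive_val.
Qed.

Let derive1n_quasi k p q : derive1n k (quasi p q) = quasi p^`(k) (iter k twist q).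
Proof.
elim: k => [|k IHk]; first by rewrite derive1n0 derivn0.
by rewrite derive1nS IHk derive1_quasi derivnS.
Qed.

Let DeltaE : Delta n tau a alpha = quasi (monic_poly n a) (delay_poly n alpha).
Proof.
have polyE (u : nat -> R) s : (Cpoly (\poly_(k < n) u k)).[s]
    = \sum_(k < n) RtoC (u k) * s ^+ k.
  rewrite /Cpoly poly_def rmorph_sum horner_sum; apply: eq_bigr => k _ /=.
  by rewrite map_polyZ map_polyXn hornerZ hornerXn.
apply/funext => s; rewrite /Delta /quasi polyE /monic_poly.
by rewrite /Cpoly rmorphD /= map_polyXn hornerD hornerXn -/(Cpoly _) polyE.
Qed.

Lemma Delta_shift s : Delta n tau a alpha s =
   (Cpoly (monic_poly n a)).[s] + cexp (- (s * RtoC tau)) * (Cpoly (delay_poly n alpha)).[s].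
Proof. by rewrite DeltaE. Qed.

Lemma derive1n_Delta k : derive1n k (Delta n tau a alpha) (RtoC s0)
  = RtoC (k`!%:R * (shift_b n s0 a k + (kpoly (shift_beta n tau s0 alpha) k).[- tau])).
Proof.
rewrite DeltaE derive1n_quasi /quasi /Cpoly.
have -> : - (RtoC s0 * RtoC tau) = RtoC (- (s0 * tau)).
  by rewrite -[RHS]/(real_complex R _) rmorphN rmorphM.
have RE x : RtoC x = real_complex R x by [].
rewrite cexp_real !RE !horner_map -rmorphM -rmorphD; congr (real_complex R _).
rewrite derivn_shift -[_ *+ _]mulr_natl mulrDr; congr (_ + _).
have -> : (iter k twist (delay_poly n alpha)).[s0]
    = (iter k twist (delay_poly n alpha) \Po ('X + s0%:P)).[0].
  by rewrite horner_comp !hornerE.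
rewrite iter_twist_shift iter_twist0 /kpoly horner_sum mulrCA mulr_sumr; congr (_ * _).
apply: eq_bigr => i _; rewrite hornerZ hornerXn /shift_beta; ring.
Qed.

Lemma root_of_multiplicityP m :
  root_of_multiplicity (Delta n tau a alpha) (RtoC s0) m <->
  (forall j, (j < m)%N ->
    shift_b n s0 a j + (kpoly (shift_beta n tau s0 alpha) j).[- tau] = 0).
Proof.
split=> H j jm; have := H j jm; rewrite derive1n_Delta.
  move=> [/eqP]; rewrite mulf_eq0 => /orP[|/eqP //].
  by rewrite pnatr_eq0 gtn_eqF // fact_gt0.
by move=> ->; rewrite mulr0.
Qed.

End Quasipolynomial.

(** * Dominance and stability *)

Section Dominance.
Context {R : realType} (N : nat) (tau s0 : R) (a alpha : nat -> R).
Hypothesis tau_gt0 : 0 < tau.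
Let n := N.+1.
Let beta := shift_beta n tau s0 alpha.
Let q j (v : R) := (kpoly beta j).[v].
(** Defined through the kernel so that [qtau] holds for every $j$; it agrees with the coefficients
    of the translated $P$ for $j<2n$ ([bE]). *)
Let b j := - q j (- tau).
Hypothesis multiple_root : forall j, (j < 2 * n)%N ->
  shift_b n s0 a j + (kpoly beta j).[- tau] = 0.

Let bE j : (j < 2 * n)%N -> b j = shift_b n s0 a j.
Proof. by move=> /multiple_root; rewrite /b /q; lra. Qed.

Let dq j (v : R) : is_derive v 1 (q j) (prev (q ^~ v) j).
Proof.
have := is_derive_poly (kpoly beta j) v; rewrite deriv_kpoly.
by case: j => [|j] //=; rewrite horner0.
Qed.

Let q0 j : q j 0 = beta j. Proof. exact: horner_kpoly0. Qed.

Let qtau j : q j (- tau) = - b j. Proof. by rewrite /b opprK. Qed.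

Let beta_gt j : (N < j)%N -> beta j = 0.
Proof. exact: shift_beta_ge. Qed.

Let b_top : b N.+1 = 1.
Proof. by rewrite bE ?shift_b_top // /n; lia. Qed.

Let b_gt j : (N.+1 < j < 2 * N.+1)%N -> b j = 0.
Proof. by move=> /andP[Nj j2]; rewrite bE // shift_b_gt. Qed.

Let shiftE (p : {poly R}) m (s : Cx R) : (size p <= m)%N ->
  (map_poly (real_complex R) p).[s]
  = \sum_(k < m) RtoC (p \Po ('X + s0%:P))`_k * (s - RtoC s0) ^+ k.
Proof.
move=> pm; have : (size (p \Po ('X + s0%:P)) <= m)%N.
  by rewrite size_comp_poly2 ?size_XaddC.
set p' := p \Po _ => p'm.
have -> : map_poly (real_complex R) p
    = map_poly (real_complex R) p' \Po ('X - (RtoC s0)%:P).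
  by rewrite -{1}(shift_polyK s0 p) map_comp_poly rmorphB /= map_polyX map_polyC.
rewrite horner_comp !hornerE (horner_coef_wide _ (n := m)) ?size_map_poly //.
by apply: eq_bigr => k _; rewrite coef_map.
Qed.

Lemma strictly_dominant : strictly_dominant_root (Delta n tau a alpha) s0.
Proof.
move=> s Ds sneq; rewrite ltNge; apply/negP => s0s.
pose sg := s - RtoC s0; pose x := complex.Re sg; pose y := complex.Im sg.
have x0 : 0 <= x by rewrite /x /sg; case: (s) s0s => u v /=; rewrite subr_ge0.
have sg0 : sg != 0 by rewrite subr_eq0; apply/eqP.
have xy0 : 0 < x ^+ 2 + y ^+ 2.
  rewrite lt0r addr_ge0 ?sqr_ge0 // andbT paddr_eq0 ?sqr_ge0 // !sqrf_eq0.
  by apply: contraNN sg0; rewrite /x /y eq_complex /=.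
pose xs k := complex.Re (sg ^+ k); pose ys k := complex.Im (sg ^+ k).
have xsS k : xs k.+1 = x * xs k - y * ys k.
  by rewrite /xs /ys /x /y exprS; case: (sg) => ? ?; case: (_ ^+ k).
have ysS k : ys k.+1 = x * ys k + y * xs k.
  by rewrite /xs /ys /x /y exprS; case: (sg) => ? ?; case: (_ ^+ k).
(* With $\sigma=s-s_0$ and $Q$ the translated delay polynomial, $A_1+iA_2=Q(\sigma)$ and
   $g_1+ig_2=Q(\sigma)e^{\sigma v}$. *)
pose A1 := \sum_(k < N.+1) beta k * xs k; pose A2 := \sum_(k < N.+1) beta k * ys k.
pose g1 v := expR (x * v) * (A1 * cos (y * v) - A2 * sin (y * v)).
pose g2 v := expR (x * v) * (A1 * sin (y * v) + A2 * cos (y * v)).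
pose r1 v := g1 v - \sum_(j < N.+1) xs j * q j v.
pose r2 v := g2 v - \sum_(j < N.+1) ys j * q j v.
have dexp (v : R) : is_derive v 1 (fun v => expR (x * v)) (expR (x * v) * x).
  exact: is_derive_dilate.
have dcos (v : R) : is_derive v 1 (fun v => cos (y * v)) (- sin (y * v) * y).
  exact: is_derive_dilate.
have dsin (v : R) : is_derive v 1 (fun v => sin (y * v)) (cos (y * v) * y).
  exact: is_derive_dilate.
have dg1 (v : R) : is_derive v 1 g1 (x * g1 v - y * g2 v).
  have := dexp v => ?; have := dcos v => ?; have := dsin v => ?.
  by rewrite /g1; apply: is_derive_eq; rewrite /g2 /GRing.scale /=; ring.
have dg2 (v : R) : is_derive v 1 g2 (x * g2 v + y * g1 v).
  have := dexp v => ?; have := dcos v => ?; have := dsin v => ?.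
  by rewrite /g2; apply: is_derive_eq; rewrite /g1 /GRing.scale /=; ring.
have dsum (u : nat -> R) (v : R) : is_derive v 1 (fun v => \sum_(j < N.+1) u j * q j v)
    (\sum_(j < N.+1) u j.+1 * q j v - u N.+1 * q N v).
  have -> : \sum_(j < N.+1) u j.+1 * q j v - u N.+1 * q N v
      = \sum_(j < N.+1) u j * prev (q ^~ v) j.
    by rewrite (sum_next N u (q ^~ v)) addrC addKr.
  by apply: is_derive_bigsum => j; have := dq j v => ?; exact: is_deriveZ.
have dr1 (v : R) : is_derive v 1 r1 (x * r1 v - y * r2 v + xs N.+1 * q N v).
  have := dg1 v => ?; have := dsum xs v => ?.
  rewrite /r1; apply: is_derive_eq.
  under eq_bigr => j _ do rewrite xsS mulrBl -!mulrA.
  rewrite sumrB -!mulr_sumr /r2; ring.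
have dr2 (v : R) : is_derive v 1 r2 (x * r2 v + y * r1 v + ys N.+1 * q N v).
  have := dg2 v => ?; have := dsum ys v => ?.
  rewrite /r2; apply: is_derive_eq.
  under eq_bigr => j _ do rewrite ysS mulrDl -!mulrA.
  rewrite big_split -!mulr_sumr /r1 /=; ring.
have r10 : r1 0 = 0.
  rewrite /r1 /g1 !mulr0 expR0 cos0 sin0 mulr0 subr0 mulr1 mul1r.
  by apply/eqP; rewrite subr_eq0; apply/eqP; apply: eq_bigr => k _; rewrite q0 mulrC.
have r20 : r2 0 = 0.
  rewrite /r2 /g2 !mulr0 expR0 cos0 sin0 mulr0 add0r mulr1 mul1r.
  by apply/eqP; rewrite subr_eq0; apply/eqP; apply: eq_bigr => k _; rewrite q0 mulrC.
(* The root equation reads $e^{-\sigma\tau}Q(\sigma)=-P(\sigma)$, and $q_j(-\tau)=-b_j$ cancels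
   every term of $P(\sigma)$ except $\sigma^n$. *)
have [r1t r2t] : r1 (- tau) = - xs N.+1 /\ r2 (- tau) = - ys N.+1.
  have hsum (u : nat -> R) m : \sum_(k < m) RtoC (u k) * sg ^+ k
      = Complex (\sum_(k < m) u k * xs k) (\sum_(k < m) u k * ys k) :> Cx R.
    elim: m => [|m IHm]; first by rewrite !big_ord0.
    rewrite !big_ord_recr IHm /xs /ys; case: (sg ^+ m) => c d /=.
    by apply/eqP; rewrite eq_complex /= !mul0r subr0 addr0 !eqxx.
  have eD : cexp (- (s * RtoC tau)) = cexp (- (sg * RtoC tau)) * RtoC (expR (- (s0 * tau))).
    rewrite -cexp_real -cexpD; congr cexp; rewrite /sg.
    have -> : RtoC (- (s0 * tau)) = - (RtoC s0 * RtoC tau).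
      by rewrite -[LHS]/(real_complex R _) rmorphN rmorphM.
    by ring.
  move: Ds; rewrite Delta_shift (@shiftE _ N.+2); last first.
    rewrite (leq_trans (size_polyD _ _)) // geq_max size_polyXn leqnn /=.
    exact: leq_trans (size_poly _ _) _.
  rewrite (@shiftE _ N.+1); last exact: size_poly.
  rewrite eD -mulrA mulr_sumr.
  under [X in _ + _ * X]eq_bigr => k _ do
    rewrite mulrA -[RtoC _ * RtoC _]/(real_complex R _ * real_complex R _) -rmorphM.
  rewrite (hsum (shift_b n s0 a)) (hsum beta).
  rewrite [\sum_(k < N.+2) _ * xs k]big_ord_recr [\sum_(k < N.+2) _ * ys k]big_ord_recr.
  rewrite /= -/n shift_b_top !mul1r -/A1 -/A2.
  have bs (u : nat -> R) : \sum_(k < N.+1) u k * q k (- tau)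
      = - \sum_(k < N.+1) shift_b n s0 a k * u k.
    rewrite -sumrN; apply: eq_bigr => k _; rewrite qtau bE ?mulrN 1?mulrC //.
    by have := ltn_ord k; rewrite /n; lia.
  rewrite /r1 /r2 !bs /g1 /g2.
  rewrite /x /y; case: (sg) => c d /= [].
  rewrite !mulr0 subr0 add0r !mulrN => e1 e2; split; lra.
have [xn yn] := kernel_no_root tau_gt0 dq q0 qtau beta_gt b_top b_gt dr1 dr2 r10 r20 r1t r2t x0 xy0.
have /eqP : sg ^+ N.+1 = 0 by apply/eqP; rewrite eq_complex -/(xs _) -/(ys _) xn yn /= eqxx.
by rewrite expf_eq0 (negPf sg0) andbF.
Qed.

(** The function $e^{s_0t}$ is a solution, and it stays at least 1 for $t\ge0$ if $s_0\ge0$. *)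
Lemma neg_of_stable : exp_stable n tau a alpha -> s0 < 0.
Proof.
move=> [C [gam [C0 [gam0 H]]]].
pose y t := expR (s0 * t).
have dky k (t : R) : is_derive t 1 (fun t => s0 ^+ k * y t) (s0 ^+ k.+1 * y t).
  have dE : is_derive t 1 y (y t * s0) by exact: is_derive_dilate.
  by apply: is_derive_eq; rewrite /GRing.scale /= exprS; ring.
have dy k : derive1n k y = fun t => s0 ^+ k * y t.
  elim: k => [|k IHk]; first by apply/funext => t; rewrite derive1n0 expr0 mul1r.
  rewrite derive1nS IHk; apply/funext => t; rewrite derive1E.
  by have := dky k t => ?; rewrite derive_val.
have ysol : dde_solution n tau a alpha y.
  split=> [k _ t|t t0]; first by rewrite dy; case: (dky k t).
  have : shift_b n s0 a 0 + (kpoly beta 0).[- tau] = 0 by exact: multiple_root.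
  rewrite /kpoly big_ord1 subnn expr0 fact0 divr1 hornerZ hornerC mulr1 /beta /shift_beta.
  have -> : shift_b n s0 a 0 = (monic_poly n a).[s0].
    by have := derivn_shift (monic_poly n a) s0 0; rewrite derivn0 mulr1n.
  have -> : (delay_poly n alpha \Po ('X + s0%:P))`_0 = (delay_poly n alpha).[s0].
    by have := derivn_shift (delay_poly n alpha) s0 0; rewrite derivn0 mulr1n.
  rewrite hornerD hornerXn !horner_poly dy /y => E.
  have -> : \sum_(k < n) a k * derive1n k y t
      = (\sum_(k < n) a k * s0 ^+ k) * expR (s0 * t).
    by rewrite mulr_suml; apply: eq_bigr => k _; rewrite dy mulrA.
  have -> : \sum_(k < n) alpha k * derive1n k y (t - tau)
      = (\sum_(k < n) alpha k * s0 ^+ k) * expR (s0 * (t - tau)).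
    by rewrite mulr_suml; apply: eq_bigr => k _; rewrite dy mulrA.
  have -> : expR (s0 * (t - tau)) = expR (- (s0 * tau)) * expR (s0 * t).
    by rewrite -expRD; congr expR; ring.
  move: E; set A := \sum_(k < n) a k * _; set B := \sum_(k < n) alpha k * _ => E.
  transitivity ((s0 ^+ n + A + expR (- (s0 * tau)) * B) * expR (s0 * t)); first by ring.
  by rewrite E mul0r.
pose M := \sum_(k < n) `|s0| ^+ k * expR (`|s0| * tau).
have HM k : (k < n)%N -> forall th, - tau <= th <= 0 -> `|derive1n k y th| <= M.
  move=> kn th /andP[th1 th2]; rewrite dy normrM normrX.
  apply: le_trans (_ : `|s0| ^+ k * expR (`|s0| * tau) <= _).
    rewrite ler_wpM2l ?exprn_ge0 // ger0_norm ?expR_ge0 // ler_expR.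
    rewrite (le_trans (ler_norm _)) // normrM ler_wpM2l // ler0_norm //.
    by rewrite lerNl.
  rewrite /M (bigD1 (Ordinal kn)) //= lerDl; apply: sumr_ge0 => i _.
  by rewrite mulr_ge0 ?exprn_ge0 ?expR_ge0.
have Hy := H y ysol M HM.
rewrite ltNge; apply/negP => s0_ge0.
have M0 : 0 <= M by apply: le_trans (HM 0%N _ 0 _); rewrite // lexx oppr_le0 ltW.
(* At this time the stability bound becomes $1\le CMe^{-CM}$, contrary to $e^x\ge1+x$. *)
have t0 : 0 <= C * M / gam by rewrite divr_ge0 ?mulr_ge0 // ltW.
have := Hy _ t0; rewrite ger0_norm ?expR_ge0 // => h.
have h1 : 1 <= C * expR (- (gam * (C * M / gam))) * M.
  by apply: le_trans h; rewrite -[leLHS]expR0 ler_expR mulr_ge0.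
have gE : gam * (C * M / gam) = C * M by rewrite mulrCA mulfV ?mulr1 // gt_eqF.
move: h1; rewrite gE mulrAC expRN ler_pdivlMr ?expR_gt0 // mul1r.
by have := expR_ge1Dx (C * M); lra.
Qed.

(** * Removal of the exponential factor from a solution *)

Section Solution.
Context (y : R -> R) (M : R).
Hypothesis ysol : dde_solution n tau a alpha y.
Hypothesis yM : forall k, (k < n)%N -> forall theta, - tau <= theta <= 0 ->
  `|derive1n k y theta| <= M.

(* act p is p(d/dt) y, for p of degree at most n. *)
Let act (p : {poly R}) t := \sum_(k < n.+1) p`_k * derive1n k y t.

Let dact (p : {poly R}) (t : R) : (size p <= n)%N ->
  is_derive t 1 (act p) (act (p * 'X) t).
Proof.
move=> pn; have -> : act p = fun t => \sum_(k < n) p`_k * derive1n k y t.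
  by apply/funext => u; rewrite /act big_ord_recr /= nth_default // mul0r addr0.
rewrite /act big_ord_recl coefMX mul0r add0r; apply: is_derive_bigsum => k.
have [dk _] := ysol.
have : is_derive t 1 (derive1n k y) (derive1n k.+1 y t).
  by rewrite derive1nS derive1E; apply/derivableP/dk.
by move=> ?; rewrite coefMX /=; exact: is_deriveZ.
Qed.

Let actD (p1 p2 : {poly R}) t : act (p1 + p2) t = act p1 t + act p2 t.
Proof. by rewrite /act -big_split; apply: eq_bigr => k _; rewrite coefD mulrDl. Qed.

Let actZ c (p : {poly R}) t : act (c *: p) t = c * act p t.
Proof. by rewrite /act mulr_sumr; apply: eq_bigr => k _; rewrite coefZ mulrA. Qed.

(** Rewrites $p(D)$ in powers of $D-s_0$. *)
Let act_shift (p : {poly R}) m t : (size p <= m)%N ->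
  act p t = \sum_(k < m) (p \Po ('X + s0%:P))`_k * act (('X - s0%:P) ^+ k) t.
Proof.
move=> pm; have : (size (p \Po ('X + s0%:P)) <= m)%N.
  by rewrite size_comp_poly2 ?size_XaddC.
set p' := p \Po _ => pm'.
have p'E : p' = \sum_(k < m) p'`_k *: 'X^k.
  rewrite -poly_def; apply/polyP => i; rewrite coef_poly.
  by case: ltnP => // mi; rewrite nth_default // (leq_trans pm').
have pE : p = \sum_(k < m) p'`_k *: ('X - s0%:P) ^+ k.
  transitivity (p' \Po ('X - s0%:P)); first by rewrite shift_polyK.
  rewrite {1}p'E linear_sum; apply: eq_bigr => k _ /=.
  by rewrite linearZ /= comp_Xn_poly.
have act0 : act 0 t = 0 by rewrite /act big1 // => k _; rewrite coef0 mul0r.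
rewrite {1}pE (big_morph (act ^~ t) (fun p1 p2 => actD p1 p2 t) act0).
by apply: eq_bigr => k _; rewrite actZ.
Qed.

(** This is the $k$-th derivative of $e^{-s_0t}y(t)$, since $D(e^{-s_0t}f)=e^{-s_0t}(D-s_0)f$. *)
Let Z k t := expR (- (s0 * t)) * act (('X - s0%:P) ^+ k) t.

Let dZ k (t : R) : (k <= N)%N -> is_derive t 1 (Z k) (Z k.+1 t).
Proof.
move=> kN.
have dx : is_derive t 1 (fun t => - (s0 * t)) (- s0).
  by apply: is_derive_eq; rewrite /GRing.scale /= mulr1.
have dE : is_derive t 1 (fun t => expR (- (s0 * t))) (expR (- (s0 * t)) * - s0).
  exact: (@is_derive1_comp _ expR (fun t => - (s0 * t)) t).
have := @dact (('X - s0%:P) ^+ k) t; rewrite size_exp_XsubC => /(_ kN) dA.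
have PS : ('X - s0%:P) ^+ k.+1
    = ('X - s0%:P) ^+ k * 'X + (- s0) *: ('X - s0%:P) ^+ k :> {poly R}.
  by rewrite exprSr mulrBr [_ * s0%:P]mulrC mul_polyC scaleNr.
by apply: is_derive_eq; rewrite /Z PS actD actZ /GRing.scale /=; ring.
Qed.

Let dde t : 0 <= t -> Z N.+1 t + \sum_(k < N.+1) b k * Z k t
  + \sum_(k < N.+1) beta k * Z k (t - tau) = 0.
Proof.
move=> t0; have [_ /(_ t t0)] := ysol.
have -> : derive1n n y t + \sum_(k < n) a k * derive1n k y t = act (monic_poly n a) t.
  rewrite /act [RHS]big_ord_recr [LHS]addrC /= /monic_poly; congr (_ + _).
    by apply: eq_bigr => k _; rewrite coefD coefXn coef_poly ltn_ord ltn_eqF // add0r.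
  by rewrite coefD coefXn coef_poly ltnn eqxx addr0 mul1r.
have -> : \sum_(k < n) alpha k * derive1n k y (t - tau) = act (delay_poly n alpha) (t - tau).
  rewrite /act [RHS]big_ord_recr /= coef_poly ltnn mul0r addr0.
  by apply: eq_bigr => k _; rewrite coef_poly ltn_ord.
rewrite (@act_shift _ N.+2) ?(@act_shift (delay_poly n alpha) N.+1) ?size_poly //; last first.
  rewrite (leq_trans (size_polyD _ _)) // geq_max size_polyXn leqnn /=.
  exact: leq_trans (size_poly _ _) _.
rewrite big_ord_recr /= -/(shift_b n s0 a n) shift_b_top mul1r.
set S1 := \sum_(k < N.+1) _; set S2 := \sum_(k < N.+1) _ => E.
have -> : \sum_(k < N.+1) b k * Z k t = expR (- (s0 * t)) * S1.
  rewrite mulr_sumr; apply: eq_bigr => k _.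
  rewrite bE; last by have := ltn_ord k; rewrite /n; lia.
  by rewrite /Z /shift_b mulrCA.
have -> : \sum_(k < N.+1) beta k * Z k (t - tau) = expR (- (s0 * t)) * S2.
  rewrite mulr_sumr; apply: eq_bigr => k _; rewrite /beta /shift_beta /Z.
  have -> : expR (- (s0 * (t - tau))) = expR (- (s0 * t)) * expR (s0 * tau).
    by rewrite -expRD; congr expR; ring.
  have := expRxMexpNx_1 (s0 * tau); move: (expR (s0 * tau)) => u.
  move: (expR (- (s0 * tau))) => v uv.
  by rewrite -[RHS]mul1r -uv; ring.
by rewrite /Z -!mulrDr [_ + S1]addrC E mulr0.
Qed.

Let M_ge0 : 0 <= M.
Proof.
apply: le_trans (yM (ltn0Sn N) (theta := 0) _); first exact: normr_ge0.
by rewrite lexx oppr_le0 ltW.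
Qed.

Hypothesis s0_lt0 : s0 < 0.

Let Z_le k u : (k <= N)%N -> - tau <= u <= 0 ->
  `|Z k u| <= (\sum_(i < n) \sum_(j < n) `|(('X - s0%:P) ^+ i)`_j|) * M.
Proof.
move=> kN /andP[u1 u2]; rewrite /Z normrM ger0_norm ?expR_ge0 //.
apply: le_trans (_ : `|act (('X - s0%:P) ^+ k) u| <= _).
  (* As $s_0<0$ and $u\le0$, the factor $e^{-s_0u}$ is at most 1. *)
  rewrite ler_piMl // -expR0 ler_expR oppr_le0.
  by rewrite mulr_le0 // ltW.
rewrite /act big_ord_recr /= [X in _ + X * _]nth_default; last by rewrite size_exp_XsubC.
rewrite mul0r addr0 (le_trans (ler_norm_sum _ _ _)) // mulr_suml.
rewrite [leRHS](bigD1 (Ordinal (kN : (k < n)%N))) //= mulr_suml.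
rewrite -[leLHS]addr0 lerD //.
  by apply: ler_sum => j _; rewrite normrM ler_wpM2l // yM // u1.
by apply: sumr_ge0 => i _; rewrite mulr_ge0 //; apply: sumr_ge0.
Qed.

Lemma solution_shift : exists2 Z : nat -> R -> R,
  [/\ (forall k (t : R), (k <= N)%N -> is_derive t 1 (Z k) (Z k.+1 t)),
      (forall t, 0 <= t -> Z N.+1 t + \sum_(k < N.+1) b k * Z k t
         + \sum_(k < N.+1) beta k * Z k (t - tau) = 0)
    & (forall k u, (k <= N)%N -> - tau <= u <= 0 ->
         `|Z k u| <= (\sum_(i < n) \sum_(j < n) `|(('X - s0%:P) ^+ i)`_j|) * M)]
  & forall t, y t = expR (s0 * t) * Z 0 t.
Proof.
exists Z => // t; rewrite /Z expr0 mulrA expRxMexpNx_1 mul1r /act big_ord_recl.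
by rewrite coef1 mul1r big1 ?addr0 // => k _; rewrite coef1 mul0r.
Qed.

End Solution.

(** With $4\epsilon\le-s_0$, $Z_0^2$ grows at most like $e^{-s_0t}$, so $y^2=e^{2s_0t}Z_0^2$ decays
    like $e^{s_0t}$. This gives the rate $-s_0/2$ for $y$. *)
Lemma stable_of_neg : s0 < 0 -> exp_stable n tau a alpha.
Proof.
move=> s0_lt0; pose eps := Num.min 1 (- s0 / 4).
have e0 : 0 < eps by rewrite lt_min ltr01 divr_gt0 // oppr_gt0.
have e1 : eps <= 1 by rewrite ge_min lexx.
have e4 : 4 * eps <= - s0.
  by have : eps <= - s0 / 4; [rewrite ge_min lexx orbT|lra].
have [K HK] := kernel_growth tau_gt0 dq q0 qtau beta_gt b_top b_gt e0 e1.
pose c := \sum_(i < n) \sum_(j < n) `|(('X - s0%:P) ^+ i)`_j|.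
(* For $v\ge0$, $v\le(1+v)^2$: this constant avoids a square root and is positive. *)
pose C := 1 + `|K| * c ^+ 2.
have c1 : 0 <= `|K| * c ^+ 2 by rewrite mulr_ge0 ?sqr_ge0.
exists C, (- s0 / 2); split; first by rewrite /C; lra.
split; first by lra.
move=> y ysol M yM t t0.
have M0 : 0 <= M by apply: le_trans (yM 0%N _ 0 _); rewrite // lexx oppr_le0 ltW.
have [Z [dZ dde Z_le] yE] := solution_shift ysol yM s0_lt0.
have := HK Z _ dZ dde Z_le t t0; rewrite -/c => h.
rewrite -[leRHS]ger0_norm; last by rewrite !mulr_ge0 ?expR_ge0 // /C; lra.
rewrite -ler_sqr ?nnegrE // !real_normK ?num_real // yE !exprMn.
have -> : expR (- (- s0 / 2 * t)) ^+ 2 = expR (s0 * t).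
  by rewrite expr2 -expRD; congr expR; lra.
apply: le_trans (_ : expR (s0 * t) ^+ 2 * (`|K| * (c * M) ^+ 2 * expR (- s0 * t)) <= _).
  rewrite ler_wpM2l ?sqr_ge0 //; apply: le_trans h _.
  apply: le_trans (_ : `|K| * (c * M) ^+ 2 * expR (4 * eps * t) <= _).
    by rewrite ler_wpM2r ?expR_ge0 // ler_wpM2r ?sqr_ge0 // ler_norm.
  apply: ler_wpM2l; first by rewrite mulr_ge0 ?sqr_ge0.
  by rewrite ler_expR ler_wpM2r.
have -> : expR (s0 * t) ^+ 2 * (`|K| * (c * M) ^+ 2 * expR (- s0 * t))
    = (`|K| * c ^+ 2) * expR (s0 * t) * M ^+ 2 * (expR (s0 * t) * expR (- s0 * t)) by ring.
rewrite mulNr expRxMexpNx_1 mulr1 ler_wpM2r ?sqr_ge0 // ler_wpM2r ?expR_ge0 //.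
by rewrite /C expr2; move: c1; set v := `|K| * _ => v0; nra.
Qed.

End Dominance.

Section MultipleRoot.
Context {R : realType} (n : nat) (tau s0 : R) (a alpha : nat -> R).
Hypothesis n_gt0 : (0 < n)%N.
Hypothesis tau_gt0 : 0 < tau.

Lemma coeff_conditions_taylor : coeff_conditions n tau s0 a alpha <->
  taylor_zero n tau (shift_b n s0 a) (shift_beta n tau s0 alpha).
Proof.
rewrite (coeff_conditionsP _ _ _ n_gt0 tau_gt0); split=> [H j j2|]; last first.
  apply: (taylor_zero_unique n_gt0 tau_gt0); first exact: shift_beta_ge.
    exact: shift_b_top.
  by move=> j /andP[nj _]; exact: shift_b_gt.
rewrite (_ : kpoly _ j = kpoly (beta_explicit n tau) j).
  rewrite (_ : shift_b n s0 a j = b_explicit n tau j) ?taylor_zero_explicit //.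
  case: (ltngtP j n) => [jn|nj|->]; first by have [] := H j jn.
    by rewrite shift_b_gt // b_explicit_gt // nj.
  by rewrite shift_b_top b_explicit_top.
apply: eq_bigr => k _; case: (ltnP k n) => kn; first by have [_ ->] := H k kn.
by rewrite shift_beta_ge // /beta_explicit kn.
Qed.

(** Turns the criterion of (c) into $s_0<0$; only the term $j=n-1$ is left in the sum. *)
Lemma a_formula_last : a_formula n tau s0 n.-1 = - (n%:R * s0) - n%:R ^+ 2 / tau.
Proof.
case: n n_gt0 => // N _; rewrite /a_formula /= big_nat1 subSnn subnn !expr1 expr0 mulr1.
rewrite binSn binn mul1n (_ : 2 * N.+1 - N - 1 = N.+1)%N; last by lia.
rewrite subn1 /= binSn factS natrM.
have N0 : N`!%:R != 0 :> R by rewrite pnatr_eq0 -lt0n fact_gt0.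
have := lt0r_neq0 tau_gt0; move: (N`!) N0 => x x0 t0.
by field; rewrite x0 t0.
Qed.

End MultipleRoot.

Theorem theorem3p1 (R : realType) (n : nat) (tau : R) (a alpha : nat -> R)
    (s0 : R) :
  (0 < n)%N -> 0 < tau ->
  (* (a) *)
  (root_of_multiplicity (Delta n tau a alpha) (RtoC s0) (2 * n)
     <-> coeff_conditions n tau s0 a alpha)
  (* (b) *)
  /\ (coeff_conditions n tau s0 a alpha ->
        strictly_dominant_root (Delta n tau a alpha) s0)
  (* (c) *)
  /\ (coeff_conditions n tau s0 a alpha ->
        (exp_stable n tau a alpha <-> - ((n%:R) ^+ 2 / tau) < a n.-1)).
Proof.
case: n => // N n_gt0 tau_gt0.
have taylor := coeff_conditions_taylor s0 a alpha n_gt0 tau_gt0.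
split; first by rewrite taylor; exact: root_of_multiplicityP.
split=> [/taylor H|H]; first exact: strictly_dominant tau_gt0 H.
have -> : (- (N.+1%:R ^+ 2 / tau) < a N.+1.-1) = (s0 < 0).
  have [-> _] := H N.+1.-1 (ltnSn N).
  by rewrite a_formula_last // ltrDr oppr_gt0 pmulr_rlt0 ?ltr0Sn.
move/taylor: H => H.
split; [exact: neg_of_stable tau_gt0 H | exact: stable_of_neg tau_gt0 H].
Qed.
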